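(* Let $\Lambda$ be a left hereditary ring. The following conditions are equivalent: (1) $\Lambda$ is a QF-$3^{+}$ ring; (2) the full subcategory $\Lambda\text{-}Mod_{PrInj}$ is reflective in $\Lambda\text{-}Mod$, and $\eta_{{}_\Lambda\Lambda}$ is a monomorphism, where $\eta$ is the unit of the reflection; (3) the full subcategory $\Lambda\text{-}Mod_{PrInj}$ is reflective in $\Lambda\text{-}Mod_{Pr}$, and $\eta_{{}_\Lambda\Lambda}$ is a monomorphism, where $\eta$ is the unit of the reflection; (4) the category $\Lambda\text{-}Mod_{Pr}$ has a full subcategory $\mathcal{X}$ such that the composition of the embedding functors $\mathcal{X}\to\Lambda\text{-}Mod_{Pr}\to\Lambda\text{-}Mod$ has a left exact left adjoint $\mathbf{r}'$, and $\eta_{{}_\Lambda\Lambda}$ is a monomorphism, where $\eta$ is the unit of the adjunction; (5) the category $\Lambda\text{-}Mod_{Pr}$ has a full subcategory $\mathcal{X}$ such that the composition of the embedding functors $\mathcal{X}\to\Lambda\text{-}Mod_{Pr}\to\Lambda\text{-}Mod$ has a left adjoint $\mathbf{r}'$ that preserves monomorphisms, and $\eta_{{}_\Lambda\Lambda}$ is a monomorphism, where $\eta$ is the unit of the adjunction; (6) the right $\Lambda$-module $Q^{l}_{max}(\Lambda)_{\Lambda}$ is projective, and there is a full and faithful functor $U:Q^{l}_{max}(\Lambda)\text{-}Mod\to\Lambda\text{-}Mod_{Pr}$ such that $Mod\,i_{{}_\Lambda\Lambda}=\mathbf{i}'U$, where $\mathbf{i}':\Lambda\text{-}Mod_{Pr}\to\Lambda\text{-}Mod$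 is the embedding functor and $Mod\,i_{{}_\Lambda\Lambda}:Q^{l}_{max}(\Lambda)\text{-}Mod\to\Lambda\text{-}Mod$ is the restriction of scalars functor along the ring embedding $i_{{}_\Lambda\Lambda}:\Lambda\rightarrowtail Q^{l}_{max}(\Lambda)$; (7) the right $\Lambda$-module $Q^{l}_{max}(\Lambda)_{\Lambda}$ is projective, and any left $Q^{l}_{max}(\Lambda)$-module is projective as a left $\Lambda$-module.
   Context: Rings are associative with identity; ''module'' means left unital $\Lambda$-module unless said otherwise; $\Lambda\text{-}Mod$ is the category of modules, and $\Lambda\text{-}Mod_{Pr}$, $\Lambda\text{-}Mod_{PrInj}$ are its full subcategories of projective modules and of modules that are both projective and injective. A ring $\Lambda$ is left QF-$3^{+}$ if the injective envelope $I({}_\Lambda\Lambda)$ of the left module ${}_\Lambda\Lambda$ is projective; for left hereditary rings this notion is left-right symmetric, so one says simply QF-$3^{+}$. $Q^{l}_{max}(\Lambda)$ is the maximal left ring of quotients of Utumi: with $E=I({}_\Lambda\Lambda)\supseteq\Lambda$, it is the left $\Lambda$-submodule $\{x\in E: h(x)=0 \text{ for all } h\in \operatorname{End}_\Lambda(E) \text{ with } h(\Lambda)=0\}$ equipped with its unique ring structure extending the left $\Lambda$-module structure; it contains $\Lambda$ as a subring (this inclusion is $i_{{}_\Lambda\Lambda}$). *)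

(* Defs.v *)
From HB Require Import structures.
From mathcomp Require Import all_boot all_algebra.
From mathcomp Require Import boolp.

Set Implicit Arguments.
Unset Strict Implicit.
Unset Printing Implicit Defensive.

Import GRing.Theory.
Local Open Scope ring_scope.

(** * Categories, functors, adjunctions *)

Record category := Category {
  Ob :> Type;
  Hom : Ob -> Ob -> Type;
  idm : forall x, Hom x x;
  cmp : forall x y z, Hom y z -> Hom x y -> Hom x z;
  cmp1m : forall x y (f : Hom x y), cmp (idm y) f = f;
  cmpm1 : forall x y (f : Hom x y), cmp f (idm x) = f;
  cmpA : forall x y z t (h : Hom z t) (g : Hom y z) (f : Hom x y),
    cmp h (cmp g f) = cmp (cmp h g) f }.

Arguments idm {c} x.
Arguments cmp {c x y z}.

Definition mono (C : category) (x y : C) (f : Hom x y) : Prop :=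
  forall z (g h : Hom z x), cmp f g = cmp f h -> g = h.

Record functor (C D : category) := Functor {
  fob :> C -> D;
  fmap : forall x y, Hom x y -> Hom (fob x) (fob y);
  fmap1 : forall x, fmap (idm x) = idm (fob x);
  fmapM : forall x y z (g : Hom y z) (f : Hom x y),
    fmap (cmp g f) = cmp (fmap g) (fmap f) }.

Arguments fmap {C D} _ {x y} _.

Definition idF (C : category) : functor C C :=
  @Functor C C (fun x => x) (fun _ _ f => f) (fun _ => erefl)
    (fun _ _ _ _ _ => erefl).

Section CompF.
Context (C D E : category) (G : functor D E) (F : functor C D).

Fact compF1 x : fmap G (fmap F (idm x)) = idm (G (F x)).
Proof. by rewrite !fmap1. Qed.

Fact compFM x y z (g : Hom y z) (f : Hom x y) :
  fmap G (fmap F (cmp g f)) = cmp (fmap G (fmap F g)) (fmap G (fmap F f)).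
Proof. by rewrite !fmapM. Qed.

Definition compF : functor C E :=
  @Functor C E (fun x => G (F x)) (fun _ _ f => fmap G (fmap F f)) compF1 compFM.

End CompF.

Definition full (C D : category) (F : functor C D) : Prop :=
  forall (x y : C) (g : Hom (F x) (F y)), exists f : Hom x y, fmap F f = g.

Definition faithful (C D : category) (F : functor C D) : Prop :=
  forall x y : C, injective (fun f : Hom x y => fmap F f).

Definition preserves_mono (C D : category) (F : functor C D) : Prop :=
  forall (x y : C) (f : Hom x y), mono f -> mono (fmap F f).

Record nattrans (C D : category) (F G : functor C D) := NatTrans {
  ncomp :> forall x, Hom (F x) (G x);
  ncompE : forall x y (f : Hom x y),
    cmp (ncomp y) (fmap F f) = cmp (fmap G f) (ncomp x) }.

(* [adjunction L G]: the functor L is left adjoint to G. *)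
Record adjunction (C D : category) (L : functor C D) (G : functor D C) :=
  Adjunction {
    unit_adj : nattrans (idF C) (compF G L);
    counit_adj : nattrans (compF L G) (idF D);
    triangleL : forall x : C,
      cmp (counit_adj (L x)) (fmap L (unit_adj x)) = idm (L x);
    triangleR : forall y : D,
      cmp (fmap G (counit_adj y)) (unit_adj (G y)) = idm (G y) }.

(** * Full subcategories *)

Definition full_sub (C : category) (P : C -> Prop) : category :=
  @Category {x : C | P x} (fun x y => Hom (sval x) (sval y))
    (fun x => idm (sval x)) (fun _ _ _ g f => cmp g f)
    (fun _ _ f => cmp1m f) (fun _ _ f => cmpm1 f)
    (fun _ _ _ _ h g f => cmpA h g f).

Definition emb (C : category) (P : C -> Prop) : functor (full_sub P) C :=
  @Functor (full_sub P) C (fun x => sval x) (fun _ _ f => f)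
    (fun _ => erefl) (fun _ _ _ _ _ => erefl).

Definition emb_sub (C : category) (P Q : C -> Prop)
    (PQ : forall x, P x -> Q x) : functor (full_sub P) (full_sub Q) :=
  @Functor (full_sub P) (full_sub Q)
    (fun x => exist Q (sval x) (PQ _ (svalP x))) (fun _ _ f => f)
    (fun _ => erefl) (fun _ _ _ _ _ => erefl).

(** * Left exact functors: preservation of finite limits *)

(* [finite_set] would force the objects of every category into the universe of
   eqType, which is too small for the class of all modules. *)
Definition finite_type (T : Type) : Prop :=
  exists (n : nat) (f : 'I_n -> T), forall x, exists i, f i = x.

Definition finite_category (J : category) : Prop :=
  finite_type J /\ forall i j : J, finite_type (Hom i j).

Record cone (J C : category) (D : functor J C) := Cone {
  apex : C;
  leg : forall j, Hom apex (D j);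
  legE : forall i j (u : Hom i j), cmp (fmap D u) (leg i) = leg j }.

Definition is_limit (J C : category) (D : functor J C) (c : cone D) : Prop :=
  forall c' : cone D, exists! u : Hom (apex c') (apex c),
    forall j, cmp (leg c j) u = leg c' j.

Section MapCone.
Context (J C C' : category) (F : functor C C') (D : functor J C) (c : cone D).

Fact map_cone_subproof i j (u : Hom i j) :
  cmp (fmap (compF F D) u) (fmap F (leg c i)) = fmap F (leg c j).
Proof. by rewrite /= -fmapM legE. Qed.

Definition map_cone : cone (compF F D) :=
  @Cone J C' (compF F D) (F (apex c)) (fun j => fmap F (leg c j))
    map_cone_subproof.

End MapCone.

Definition left_exact (C D : category) (F : functor C D) : Prop :=
  forall (J : category), finite_category J ->
  forall (X : functor J C) (c : cone X), is_limit c -> is_limit (map_cone F c).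

(** * Modules *)

Section LinearExt.
Context (R : pzRingType) (U V : lmodType R).

Lemma linear_ext (f g : {linear U -> V}) : f =1 g -> f = g.
Proof.
case: f g => [f cf] [g cg] /= /funext fg; subst g; congr GRing.Linear.Pack.
case: cf cg => [[a] [b]] [[a'] [b']].
by rewrite (Prop_irrelevance a a') (Prop_irrelevance b b').
Qed.

End LinearExt.

Section Submodule.
Context (R : pzRingType) (V : lmodType R) (S : submodClosed V).

Definition submod : Type := {x : V | x \in S}.

HB.instance Definition _ := Choice.on submod.
HB.instance Definition _ := SubType.on submod.
HB.instance Definition _ := [SubChoice_isSubLmodule of submod by <:].

End Submodule.

Section Mod.
Context (R : pzRingType).

Definition lin_id (M : lmodType R) : {linear M -> M} := idfun.
Definition lin_comp (M N P : lmodType R) (g : {linear N -> P})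
  (f : {linear M -> N}) : {linear M -> P} := g \o f.

Fact lin_comp1m (M N : lmodType R) (f : {linear M -> N}) :
  lin_comp (lin_id N) f = f.
Proof. exact: linear_ext. Qed.

Fact lin_compm1 (M N : lmodType R) (f : {linear M -> N}) :
  lin_comp f (lin_id M) = f.
Proof. exact: linear_ext. Qed.

Fact lin_compA (M N P S : lmodType R) (h : {linear P -> S})
    (g : {linear N -> P}) (f : {linear M -> N}) :
  lin_comp h (lin_comp g f) = lin_comp (lin_comp h g) f.
Proof. exact: linear_ext. Qed.

Definition Mod : category :=
  @Category (lmodType R) (fun M N => {linear M -> N}) lin_id lin_comp
    lin_comp1m lin_compm1 lin_compA.

Definition projective_module (P : lmodType R) : Prop :=
  forall (M N : lmodType R) (g : {linear M -> N}) (f : {linear P -> N}),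
    (forall y, exists x, g x = y) ->
    exists h : {linear P -> M}, forall p, g (h p) = f p.

Definition injective_module (E : lmodType R) : Prop :=
  forall (M N : lmodType R) (g : {linear M -> N}) (f : {linear M -> E}),
    injective g ->
    exists h : {linear N -> E}, forall m, h (g m) = f m.

Definition ModPr : category := full_sub (C := Mod) projective_module.

Definition ModPrInj : category :=
  full_sub (C := Mod) (fun M => projective_module M /\ injective_module M).

Definition embPr : functor ModPr Mod := @emb Mod projective_module.

Definition embPrInj : functor ModPrInj Mod :=
  @emb Mod (fun M => projective_module M /\ injective_module M).

Definition embPrInjPr : functor ModPrInj ModPr :=
  @emb_sub Mod (fun M => projective_module M /\ injective_module M)
    projective_module (fun _ PI => proj1 PI).

Lemma projective_regular : projective_module R^o.
Proof.
move=> M N g f /(_ (f 1))[x gx].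
pose h (a : R^o) : M := (a : R) *: x.
have hP : linear h by move=> a u v; rewrite /h scalerDl scalerA.
pose hL := GRing.isLinear.Build R R^o M *:%R h hP.
pose hl : {linear R^o -> M} := HB.pack h hL.
exists hl => p; rewrite /= /h linearZ /= gx -linearZ /=.
by congr (f _); rewrite /GRing.scale /= mulr1.
Qed.

(* The left module R over itself, as an object of the two categories. *)
Definition regMod : Mod := (R^o : lmodType R).
Definition regModPr : ModPr := exist _ (R^o : lmodType R) projective_regular.

(* Left ideals of R are the submodules of R^o. *)
Definition left_hereditary : Prop :=
  forall S : submodClosed R^o, projective_module (submod S).

Definition essential (M E : lmodType R) (iota : {linear M -> E}) : Prop :=
  forall S : submodClosed E,
    (forall m, iota m \in S -> iota m = 0) -> forall x, x \in S -> x = 0.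

Definition injective_envelope (M E : lmodType R) (iota : {linear M -> E}) :
    Prop :=
  [/\ injective iota, injective_module E & essential iota].

Definition left_QF3plus : Prop :=
  exists (E : lmodType R) (iota : {linear R^o -> E}),
    injective_envelope iota /\ projective_module E.

End Mod.

(** * Restriction of scalars *)

Definition restr (A B : pzRingType) (phi : {rmorphism A -> B})
  (N : lmodType B) : Type := N.

(* B as a right A-module along phi, i.e. as a left module over the converse
   ring of A: a acts by q |-> q * phi a. *)
Definition right_restr (A B : pzRingType) (phi : {rmorphism A -> B}) : Type := B.

Section Restriction.
Context (A B : pzRingType) (phi : {rmorphism A -> B}).

Section Object.
Context (N : lmodType B).
Local Notation restr := (restr phi N).

HB.instance Definition _ := GRing.Zmodule.on restr.

Definition restr_scale (a : A) (x : restr) : restr := phi a *: (x : N).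

Fact restr_scaleA a b x : restr_scale a (restr_scale b x) = restr_scale (a * b) x.
Proof. by rewrite /restr_scale scalerA rmorphM. Qed.

Fact restr_scale1 : left_id 1 restr_scale.
Proof. by move=> x; rewrite /restr_scale rmorph1 scale1r. Qed.

Fact restr_scaleDr : right_distributive restr_scale +%R.
Proof. by move=> a x y; rewrite /restr_scale scalerDr. Qed.

Fact restr_scaleDl x : {morph restr_scale^~ x : a b / a + b}.
Proof. by move=> a b; rewrite /restr_scale rmorphD scalerDl. Qed.

HB.instance Definition _ := GRing.Zmodule_isLmodule.Build A restr
  restr_scaleA restr_scale1 restr_scaleDr restr_scaleDl.

End Object.

Section Morphism.
Context (M N : lmodType B) (f : {linear M -> N}).

Definition restr_fun : restr phi M -> restr phi N := f.

Fact restr_fun_linear : linear restr_fun.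
Proof. by move=> a x y; rewrite /restr_fun linearP. Qed.

HB.instance Definition _ :=
  GRing.isLinear.Build A (restr phi M) (restr phi N) *:%R restr_fun restr_fun_linear.

Definition restr_map : {linear restr phi M -> restr phi N} := restr_fun.

End Morphism.

Fact restr_map1 (M : lmodType B) : restr_map (lin_id M) = lin_id (restr phi M).
Proof. exact: linear_ext. Qed.

Fact restr_mapM (M N P : lmodType B) (g : {linear N -> P})
    (f : {linear M -> N}) :
  restr_map (lin_comp g f) = lin_comp (restr_map g) (restr_map f).
Proof. exact: linear_ext. Qed.

Definition Mod_restr : functor (Mod B) (Mod A) :=
  @Functor (Mod B) (Mod A) (fun N => restr phi N : lmodType A)
    (fun M N f => restr_map f) restr_map1 restr_mapM.

Local Notation right_restr := (right_restr phi).

HB.instance Definition _ := GRing.Zmodule.on right_restr.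

Definition right_scale (a : A^c) (q : right_restr) : right_restr :=
  (q : B) * phi (a : A).

Fact right_scaleA (a b : A^c) q :
  right_scale a (right_scale b q) = right_scale (a * b) q.
Proof. by rewrite /right_scale -mulrA -rmorphM. Qed.

Fact right_scale1 : left_id 1 right_scale.
Proof. by move=> q; rewrite /right_scale rmorph1 mulr1. Qed.

Fact right_scaleDr : right_distributive right_scale +%R.
Proof. by move=> a q q'; rewrite /right_scale mulrDl. Qed.

Fact right_scaleDl q : {morph right_scale^~ q : a b / a + b}.
Proof. by move=> a b; rewrite /right_scale rmorphD mulrDr. Qed.

HB.instance Definition _ := GRing.Zmodule_isLmodule.Build A^c right_restr
  right_scaleA right_scale1 right_scaleDr right_scaleDl.

End Restriction.

(** * The maximal left ring of quotients *)

Section QmaxSubmodule.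
Context (R : pzRingType) (E : lmodType R) (iota : {linear R^o -> E}).

Definition Qmax_pred : {pred E} := fun x =>
  `[< forall h : {linear E -> E}, (forall a, h (iota a) = 0) -> h x = 0 >].

Lemma Qmax_predP x : reflect
  (forall h : {linear E -> E}, (forall a, h (iota a) = 0) -> h x = 0)
  (x \in Qmax_pred).
Proof. exact: asboolP. Qed.

Fact Qmax_closed : submod_closed Qmax_pred.
Proof.
split=> [|a u v /Qmax_predP uQ /Qmax_predP vQ]; apply/Qmax_predP => h h0.
  by rewrite linear0.
by rewrite linearP uQ// vQ// scaler0 addr0.
Qed.

HB.instance Definition _ :=
  GRing.isSubmodClosed.Build R E Qmax_pred (GRing.submod_closed_semi Qmax_closed).

Lemma iota_Qmax a : iota a \in Qmax_pred.
Proof. by apply/Qmax_predP => h; apply. Qed.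

End QmaxSubmodule.

Section Qmax.
Context (R : pzRingType) (E : lmodType R) (iota : {linear R^o -> E}).

Definition Qmax (envE : injective_envelope iota) : Type :=
  submod (Qmax_pred iota).

Context (envE : injective_envelope iota).
Local Notation Q := (Qmax envE).

HB.instance Definition _ := GRing.SubLmodule.on Q.

Fact right_mul_ext (y : E) :
  exists h : {linear E -> E}, forall a : R^o, h (iota a) = (a : R) *: y.
Proof.
case: envE => iota_inj injE _.
pose m (a : R^o) : E := (a : R) *: y.
have mP : linear m by move=> a u v; rewrite /m scalerDl scalerA.
pose hm := GRing.isLinear.Build R R^o E *:%R m mP.
pose f : {linear R^o -> E} := HB.pack m hm.
exact: (injE _ _ _ f iota_inj).
Qed.

(* The product x * y in Qmax is h x, where h is any endomorphism of E that
   extends a |-> a *: y; elements of Qmax are those on which h x does not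
   depend on the choice of h. *)
Definition right_mul (y : E) : {linear E -> E} := sval (cid (right_mul_ext y)).

Lemma right_mulE y (a : R^o) : right_mul y (iota a) = (a : R) *: y.
Proof. exact: (svalP (cid (right_mul_ext y))). Qed.

Lemma Qmax_ext (x : Q) (g h : {linear E -> E}) :
  (forall a, g (iota a) = h (iota a)) -> g (val x) = h (val x).
Proof.
move=> gh; apply/subr0_eq.
have /Qmax_predP/(_ (g \- h)) := valP x; apply=> a.
by rewrite /= gh subrr.
Qed.

Fact Qmax_mul_subproof (x y : Q) :
  right_mul (val y) (val x) \in Qmax_pred iota.
Proof.
apply/Qmax_predP => h h0.
rewrite -[LHS]/(lin_comp h (right_mul (val y)) (val x)).
have /Qmax_predP := valP x; apply=> a /=.
by rewrite right_mulE linearZ /=; have /Qmax_predP -> := valP y; rewrite ?scaler0.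
Qed.

Definition Qmax_one : Q := Sub (iota 1) (iota_Qmax iota 1).
Definition Qmax_mul (x y : Q) : Q :=
  Sub (right_mul (val y) (val x)) (Qmax_mul_subproof x y).

Lemma val_Qmax_mul x y : val (Qmax_mul x y) = right_mul (val y) (val x).
Proof. by []. Qed.

Lemma iotaZ (a : R) : iota a = a *: iota 1.
Proof. by rewrite -linearZ /= /GRing.scale /= mulr1. Qed.

Fact Qmax_mulA : associative Qmax_mul.
Proof.
move=> x y z; apply: val_inj; rewrite !val_Qmax_mul.
rewrite -[RHS]/(lin_comp (right_mul (val z)) (right_mul (val y)) (val x)).
by apply: Qmax_ext => a /=; rewrite !right_mulE linearZ.
Qed.

Fact Qmax_mul1 : left_id Qmax_one Qmax_mul.
Proof. by move=> y; apply: val_inj; rewrite val_Qmax_mul right_mulE scale1r. Qed.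

Fact Qmax_mulr1 : right_id Qmax_one Qmax_mul.
Proof.
move=> x; apply: val_inj; rewrite val_Qmax_mul -[RHS]/(lin_id E (val x)).
by apply: Qmax_ext => a; rewrite right_mulE /= -iotaZ.
Qed.

Fact Qmax_mulDl : left_distributive Qmax_mul +%R.
Proof. by move=> x y z; apply: val_inj; rewrite /= linearD. Qed.

Fact Qmax_mulDr : right_distributive Qmax_mul +%R.
Proof.
move=> x y z; apply: val_inj; rewrite /=.
pose h : {linear E -> E} := right_mul (val y) \+ right_mul (val z).
rewrite -[RHS]/(h (val x)).
by apply: Qmax_ext => a; rewrite /= !right_mulE scalerDr.
Qed.

HB.instance Definition _ := GRing.Zmodule_isPzRing.Build Q
  Qmax_mulA Qmax_mul1 Qmax_mulr1 Qmax_mulDl Qmax_mulDr.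

Definition Qmax_inj (a : R) : Q := Sub (iota a) (iota_Qmax iota a).

Fact Qmax_inj_is_zmod_morphism : zmod_morphism Qmax_inj.
Proof. by move=> a b; apply: val_inj; rewrite /= linearB. Qed.

Fact Qmax_inj_is_monoid_morphism : monoid_morphism Qmax_inj.
Proof.
split=> [|a b]; apply: val_inj => //=.
by rewrite right_mulE (iotaZ b) scalerA -iotaZ.
Qed.

HB.instance Definition _ :=
  GRing.isZmodMorphism.Build R Q Qmax_inj Qmax_inj_is_zmod_morphism.
HB.instance Definition _ :=
  GRing.isMonoidMorphism.Build R Q Qmax_inj Qmax_inj_is_monoid_morphism.

Definition Qmax_incl : {rmorphism R -> Q} := Qmax_inj.

Lemma Qmax_incl_inj : injective Qmax_incl.
Proof. by case: envE => iota_inj _ _ a b /(congr1 val) /iota_inj. Qed.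

(* The product of Qmax extends its left R-module structure, and it is the only
   biadditive associative operation that does. *)
Lemma Qmax_inclM (a : R) (x : Q) : Qmax_incl a * x = a *: x.
Proof. by apply: val_inj; rewrite /= right_mulE. Qed.

Lemma Qmax_mul_uniq (mul : Q -> Q -> Q) :
  associative mul -> left_distributive mul +%R ->
  (forall (a : R) (x : Q), mul (Qmax_incl a) x = a *: x) ->
  forall x y, mul x y = x * y.
Proof.
move=> mulA mulDl mulE x y; apply: val_inj => /=.
pose m (z : Q) : E := val (mul z y).
have mP : linear m.
  move=> a u v; rewrite /m mulDl -mulE -mulA mulE.
  by rewrite -[LHS]/(a *: val (mul u y) + val (mul v y)).
pose hm := GRing.isLinear.Build R Q E *:%R m mP.
pose f : {linear Q -> E} := HB.pack m hm.
case: envE => _ injE _.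
have [h hE] := injE _ _ (val : {linear Q -> E}) f val_inj.
rewrite -[LHS]/(f x) -hE; apply: Qmax_ext => a.
by rewrite right_mulE -[iota a]/(val (Qmax_incl a)) hE /= /m mulE.
Qed.

End Qmax.

(* Main.v *)
(* Let E be the injective envelope of R and assume that it is projective.  Since
   R is nonsingular, E is the maximal quotient ring Q, and a functional on a
   module is determined on any essential submodule; hence a projective module
   with a finitely generated essential submodule is finitely generated.  As E
   embeds in some R^n, all its submodules are projective.

   If E contained an infinite independent family (v_n), then E, being injective,
   would contain submodules "spanned" by arbitrary parts of N, and a sum of these
   over a family of parts that is not countably generated would be a projective
   module that cannot be countably generated, although its functionals are
   determined by the countably many v_n.  So E and R are left noetherian.

   A submodule whose annihilators are maximal embeds in each of its nonzero
   submodules; extending the inverse of such an embedding to E yields an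
   ascending chain, which must stop, so the submodule is simple.  Thus R has
   essential left socle.  The ideal of those t with tQ contained in R contains
   the socle, hence generates Q as a left ideal of Q (this left ideal is a
   quotient of copies of E, so injective, and essential).  A relation
   1 = sum u_j t_j with t_j Q contained in R is a dual basis of the right module
   Q_R; it makes R-linear maps between Q-modules Q-linear and describes Q (x) M
   as the fixed points of the idempotent matrix (t_j u_k) on M^n, a left exact
   reflection.  Finally Q-modules are quotients of direct sums of copies of E by
   submodules of the same kind, so they are injective and projective over R.

   Conversely, each of the conditions (2)-(5) gives a map from E to a projective
   module that is injective on R, hence split injective, and (7) applies to Q,
   which is E. *)
Require Import Defs.
From HB Require Import structures.
From mathcomp Require Import all_boot all_algebra.
From mathcomp Require Import boolp classical_sets functions fsbigop.
(* [Hom] and [full] of [Defs] are shadowed by mathcomp notions. *)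
Import Defs.

Set Implicit Arguments.
Unset Strict Implicit.
Unset Printing Implicit Defensive.

Import GRing.Theory.
Local Open Scope ring_scope.

(** * Modules, direct sums and injectivity *)

Section Builders.
Context (R : pzRingType).

Definition mklin (U V : lmodType R) (f : U -> V) (fP : linear f) :
  {linear U -> V} := HB.pack f (GRing.isLinear.Build R U V *:%R f fP).

Definition is_submod (V : lmodType R) (P : V -> Prop) : Prop :=
  P 0 /\ forall a u v, P u -> P v -> P (a *: u + v).

Section Submod.
Context (V : lmodType R) (P : V -> Prop) (hP : is_submod P).

Definition prop_pred of is_submod P : {pred V} := fun x => `[< P x >].

Fact prop_pred_closed : submod_closed (prop_pred hP).
Proof.
case: (hP) => P0 PD; split; first exact/asboolP.
by move=> a u v /asboolP uP /asboolP vP; apply/asboolP/PD.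
Qed.

HB.instance Definition _ :=
  GRing.isSubmodClosed.Build R V (prop_pred hP)
    (GRing.submod_closed_semi prop_pred_closed).

Definition mksub : submodClosed V := prop_pred hP.

Lemma in_mksub x : (x \in mksub) <-> P x.
Proof. by split=> /asboolP. Qed.

End Submod.

Lemma submodClosedP (V : lmodType R) (S : submodClosed V) :
  is_submod (fun x => x \in S).
Proof. by split=> [|a u v uS vS]; rewrite ?rpred0// rpredD// rpredZ. Qed.

Section SubmodOps.
Context (V : lmodType R) (P : V -> Prop) (hP : is_submod P).

Lemma is_submodD u v : P u -> P v -> P (u + v).
Proof. by move=> uP vP; rewrite -[u]scale1r; apply: hP.2. Qed.

Lemma is_submodZ a u : P u -> P (a *: u).
Proof. by move=> uP; rewrite -[_ *: _]addr0; apply: hP.2 => //; apply: hP.1. Qed.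

Lemma is_submodB u v : P u -> P v -> P (u - v).
Proof. by move=> uP vP; rewrite addrC -scaleN1r; apply: hP.2. Qed.

Lemma is_submod_sum (I : Type) (r : seq I) (F : I -> V) :
  (forall i, P (F i)) -> P (\sum_(i <- r) F i).
Proof.
by move=> PF; elim/big_rec: _ => [|i x _ Px]; [apply: hP.1|apply: is_submodD].
Qed.

End SubmodOps.

Lemma is_submod_ker (U V : lmodType R) (f : {linear U -> V}) :
  is_submod (fun x => f x = 0).
Proof. by split=> [|a u v fu fv]; rewrite ?linear0// linearP fu fv scaler0 addr0. Qed.

Lemma is_submod_image (U V : lmodType R) (f : {linear U -> V}) :
  is_submod (fun y => exists x, f x = y).
Proof.
split=> [|a u v [x <-] [y <-]]; first by exists 0; rewrite linear0.
by exists (a *: x + y); rewrite linearP.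
Qed.

Lemma linear_injective (U V : lmodType R) (f : {linear U -> V}) :
  (forall x, f x = 0 -> x = 0) -> injective f.
Proof.
by move=> f0 x y fxy; apply/subr0_eq/f0; rewrite linearB fxy subrr.
Qed.

Lemma projective_retract (P Q : lmodType R) (i : {linear P -> Q})
    (r : {linear Q -> P}) :
  (forall x, r (i x) = x) -> projective_module Q -> projective_module P.
Proof.
move=> ri projQ M N g f gsurj.
have [h hE] := projQ M N g (lin_comp f r) gsurj.
by exists (lin_comp h i) => p; rewrite /= hE /= ri.
Qed.

Lemma injective_split (E M : lmodType R) (i : {linear E -> M}) :
  injective_module E -> injective i ->
  exists r : {linear M -> E}, forall x, r (i x) = x.
Proof. by move=> injE iinj; apply: (injE _ _ i (lin_id E)). Qed.

Definition smul (M : lmodType R) (x : M) : {linear R^o -> M}.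
Proof.
refine (@mklin R^o M (fun r : R => r *: x) _).
by move=> a u v /=; rewrite scalerDl scalerA.
Defined.

Lemma smulE (M : lmodType R) (x : M) (r : R) : smul x r = r *: x.
Proof. by []. Qed.

Lemma linear_smul (M : lmodType R) (f : {linear R^o -> M}) (r : R) :
  f r = r *: f 1.
Proof. by rewrite -linearZ /= /GRing.scale /= mulr1. Qed.

(** The kernel condition makes [be] a map on the image of [al], which extends to [M] since [E] is
    injective. *)
Lemma injective_factor (E F M : lmodType R) (al : {linear F -> M})
    (be : {linear F -> E}) :
  injective_module E -> (forall x, al x = 0 -> be x = 0) ->
  exists h : {linear M -> E}, forall x, h (al x) = be x.
Proof.
move=> injE ker.
pose S := mksub (is_submod_image al).
have pre (y : submod S) : exists x, al x = val y.
  exact/(in_mksub (is_submod_image al))/valP.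
pose f (y : submod S) : E := be (sval (cid (pre y))).
have fE x y : al x = val y -> f y = be x.
  rewrite /f; case: cid => x' /= <- /eqP; rewrite -subr_eq0 -linearB => /eqP.
  by move/ker/eqP; rewrite linearB subr_eq0 => /eqP.
have flin : linear f.
  move=> a u v; case: (pre u) (pre v) => [x xu] [y yv].
  by rewrite (fE x u)// (fE y v)// (fE (a *: x + y)) ?linearP//= xu yv.
have [h hE] := injE _ _ (val : {linear submod S -> M}) (mklin flin) val_inj.
exists h => x.
have xS : al x \in S by apply/in_mksub; exists x.
by rewrite -[al x]/(val (Sub (al x) xS : submod S)) hE /=; apply: fE.
Qed.

End Builders.

(** * Direct sums of copies of a module *)

Section DirectSum.
Context (R : pzRingType) (I : choiceType) (V : lmodType R).

Lemma is_submod_dsum : is_submod (fun f : I -> V =>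
  exists s : seq I, forall i, i \notin s -> f i = 0).
Proof.
split=> [|a f g [s sf] [t tg]]; first by exists [::].
exists (s ++ t) => i; rewrite mem_cat => /norP[/sf fi /tg gi].
by rewrite -[LHS]/(a *: f i + g i) fi gi scaler0 addr0.
Qed.

Definition dsum : Type := submod (mksub is_submod_dsum).

HB.instance Definition _ := GRing.SubLmodule.on dsum.

Definition dval (f : dsum) : I -> V := val f.

Lemma dval_inj (f g : dsum) : dval f =1 dval g -> f = g.
Proof. by move=> fg; apply/val_inj/funext. Qed.

Lemma dval_linear i : linear (fun f => dval f i).
Proof. by []. Qed.

Definition dcoord i : {linear dsum -> V} := mklin (@dval_linear i).

Lemma dvalD f g i : dval (f + g) i = dval f i + dval g i.
Proof. exact: (linearD (dcoord i)). Qed.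

Lemma dvalZ a f i : dval (a *: f) i = a *: dval f i.
Proof. exact: (linearZ_LR (dcoord i)). Qed.

Lemma dval_sum (J : Type) (r : seq J) (F : J -> dsum) i :
  dval (\sum_(j <- r) F j) i = \sum_(j <- r) dval (F j) i.
Proof. exact: (raddf_sum (dcoord i)). Qed.

(** A chosen list without repetitions; it may be larger than the support. *)
Definition dsupp (f : dsum) : seq I :=
  undup (sval (cid ((in_mksub is_submod_dsum (val f)).1 (valP f)))).

Lemma dsupp_uniq f : uniq (dsupp f). Proof. exact: undup_uniq. Qed.

Lemma dsuppP f i : i \notin dsupp f -> dval f i = 0.
Proof. by rewrite mem_undup; case: cid => s /= sf /sf. Qed.

Arguments dval : simpl never.

Section Mkdsum.
Context (s : seq I) (f : I -> V).

Fact mkdsum_subproof :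
  (fun i => if i \in s then f i else 0) \in mksub is_submod_dsum.
Proof. by apply/in_mksub; exists s => i /negPf ->. Qed.

Definition mkdsum : dsum :=
  (Sub (fun i => if i \in s then f i else 0) mkdsum_subproof :
    submod (mksub is_submod_dsum)).

Lemma dval_mkdsum i : dval mkdsum i = if i \in s then f i else 0.
Proof. by []. Qed.

End Mkdsum.

Definition single (i : I) (v : V) : dsum := mkdsum [:: i] (fun=> v).

Lemma dval_single i v j : dval (single i v) j = if j == i then v else 0.
Proof. by rewrite dval_mkdsum inE. Qed.

Section Sum.
Context (W : lmodType R) (F : I -> {linear V -> W}).

Definition dsum_fun (f : dsum) : W := \sum_(i <- dsupp f) F i (dval f i).

Lemma dsum_funE (s : seq I) (f : dsum) :
  uniq s -> (forall i, i \notin s -> dval f i = 0) ->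
  dsum_fun f = \sum_(i <- s) F i (dval f i).
Proof.
(* Both sums equal a finitely supported sum over all of [I], which depends on no list. *)
have sumE t : uniq t -> (forall i, i \notin t -> dval f i = 0) ->
    \sum_(i <- t) F i (dval f i) = \sum_(i \in [set` predT]) F i (dval f i).
  move=> ut tf; apply: (@bigfs _ _ _ _ _ predT) => // i _ /tf ->.
  exact: linear0.
by move=> us sf; rewrite /dsum_fun !sumE// ?dsupp_uniq// => i /dsuppP.
Qed.

Fact dsum_fun_linear : linear dsum_fun.
Proof.
move=> a f g; set s := undup (dsupp f ++ dsupp g).
have us : uniq s by exact: undup_uniq.
have sf i : i \notin s -> dval f i = 0.
  by rewrite mem_undup mem_cat => /norP[/dsuppP].
have sg i : i \notin s -> dval g i = 0.
  by rewrite mem_undup mem_cat => /norP[_ /dsuppP].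
rewrite !(@dsum_funE s)//; last first.
  by move=> i si; rewrite dvalD dvalZ sf// sg// scaler0 addr0.
rewrite scaler_sumr -big_split /=; apply: eq_bigr => i _.
by rewrite dvalD dvalZ linearP.
Qed.

(* opaque, since simplification would unfold the sum otherwise *)
Fact dsum_lin_subproof : {h : {linear dsum -> W} | h =1 dsum_fun}.
Proof. by exists (mklin dsum_fun_linear). Qed.

Definition dsum_lin : {linear dsum -> W} := sval dsum_lin_subproof.

Lemma dsum_lin_seq (s : seq I) (f : dsum) :
  uniq s -> (forall i, i \notin s -> dval f i = 0) ->
  dsum_lin f = \sum_(i <- s) F i (dval f i).
Proof. by rewrite (svalP dsum_lin_subproof); exact: dsum_funE. Qed.

Lemma dsum_lin_single i v : dsum_lin (single i v) = F i v.
Proof.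
rewrite (@dsum_lin_seq [:: i])// ?big_seq1 ?dval_single ?eqxx// => j.
by rewrite inE dval_single => /negPf ->.
Qed.

End Sum.


Lemma dsum_decomp (s : seq I) (f : dsum) :
  uniq s -> (forall i, i \notin s -> dval f i = 0) ->
  f = \sum_(i <- s) single i (dval f i).
Proof.
move=> us sf; apply/dval_inj => j; rewrite dval_sum.
have [js|js] := boolP (j \in s).
  rewrite (bigD1_seq j)//= dval_single eqxx big1 ?addr0// => i /negPf ij.
  by rewrite dval_single eq_sym ij.
rewrite sf// big1_seq// => i /andP[_ si]; rewrite dval_single.
by case: eqP si js => // -> ->.
Qed.

Lemma dsum_lin_ext (W : lmodType R) (g h : {linear dsum -> W}) :
  (forall i v, g (single i v) = h (single i v)) -> g =1 h.
Proof.
move=> gh f; rewrite (dsum_decomp (dsupp_uniq f) (@dsuppP f)) !raddf_sum.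
by apply: eq_bigr => i _; exact: gh.
Qed.

Lemma single_linear i : linear (single i).
Proof.
move=> a u v; apply/dval_inj => j; rewrite dvalD dvalZ !dval_single.
by case: eqP => _ //; rewrite scaler0 addr0.
Qed.

Definition single_lin i : {linear V -> dsum} := mklin (@single_linear i).

Lemma projective_dsum : projective_module V -> projective_module dsum.
Proof.
move=> projV M N g f gsurj.
have /choice[h hE] (i : I) :
    exists h : {linear V -> M}, forall v, g (h v) = f (single i v).
  by have [h hE] := projV _ _ g (lin_comp f (single_lin i)) gsurj; exists h.
exists (dsum_lin h) => p.
rewrite -[LHS]/(lin_comp g (dsum_lin h) p); apply: dsum_lin_ext => i v /=.
by rewrite dsum_lin_single.
Qed.

End DirectSum.

(** * Dual bases of projective modules *)

Section DualBasis.
Context (R : pzRingType) (P : lmodType R).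

Definition dual_basis (I : choiceType) (m : I -> P)
    (phi : I -> {linear P -> R^o}) : Prop :=
  forall x, (exists s : seq I, forall i, i \notin s -> phi i x = 0) /\
    forall s : seq I, uniq s -> (forall i, i \notin s -> phi i x = 0) ->
      x = \sum_(i <- s) (phi i x : R) *: m i.

(** The functionals are the coordinates of a splitting of the free cover of [P] on the set of all
    its elements. *)
Lemma projective_dual_basis : projective_module P ->
  exists phi : P -> {linear P -> R^o}, dual_basis (fun i => i) phi.
Proof.
move=> projP.
have surj y : exists x, dsum_lin (@smul R P) x = y.
  by exists (single y (1 : R^o)); rewrite dsum_lin_single smulE scale1r.
have [h hE] := projP _ _ (dsum_lin (@smul R P)) (lin_id P) surj.
exists (fun i => lin_comp (dcoord _ i) h) => x; split.
  by exists (dsupp (h x)) => i /dsuppP.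
move=> s us sx; rewrite -[LHS](hE x).
by rewrite (dsum_lin_seq _ us).
Qed.

End DualBasis.

(** * Complements by Zorn's lemma *)

Section Zorn.
Context (R : pzRingType) (M : lmodType R).
Local Open Scope classical_set_scope.

Lemma maximal_disjoint (A B : M -> Prop) :
  is_submod A -> (forall x, A x -> B x -> x = 0) ->
  exists C : M -> Prop, [/\ is_submod C, forall x, A x -> C x,
    forall x, C x -> B x -> x = 0 &
    forall C' : M -> Prop, is_submod C' -> (forall x, C x -> C' x) ->
      (forall x, C' x -> B x -> x = 0) -> forall x, C' x -> C x].
Proof.
move=> submodA AB.
(* Joining [A] makes the empty chain admissible: its union is empty, and [A] itself has the required
   properties. *)
pose good (X : set M) := is_submod (X `|` A) /\
  (forall x, (X `|` A) x -> B x -> x = 0).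
have [|X [[submodX XB] Xmax]] := @Zorn_bigcup M good.
  move=> F Fgood Ftot; split; last first.
    move=> x [[X FX Xx]|/AB//]; apply: (Fgood X FX).2; first by left.
  split=> [|a u v]; first by right; exact: submodA.1.
  have key X w z : F X -> (X `|` A) w -> (X `|` A) z ->
      (\bigcup_(Y in F) Y `|` A) (a *: w + z).
    by move=> FX /((Fgood X FX).1.2 a w z)/[apply] -[Xs|As];
      [left; exists X|right].
  move=> [[X FX Xu]|Au] [[Y FY Yv]|Av].
  - by have [XY|YX] := Ftot X Y FX FY;
      [apply: (key Y)|apply: (key X)] => //; left; do ?[exact: XY|exact: YX].
  - by apply: (key X) => //; [left|right].
  - by apply: (key Y) => //; [right|left].
  - by right; exact: submodA.2.
exists (X `|` A); split=> // [x Ax|C' submodC' XC' C'B x C'x]; first by right.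
have [C'X|C'X] := EM (C' `<=` X); first by left; exact: C'X.
exfalso; apply: (Xmax C'); first by split=> // z Xz; apply: XC'; left.
have -> : good C' = (is_submod C' /\ forall x, C' x -> B x -> x = 0).
  by rewrite /good setUidl// => z Az; apply: XC'; right.
by [].
Qed.

(** [C] is maximal among the submodules meeting [B] in zero. If no multiple of [x] were a nonzero
    element of [B + C], then [C + Rx] would still meet [B] in zero, so [x] itself would lie in
    [C]. *)
Lemma essential_complement (B : M -> Prop) : is_submod B ->
  exists C : M -> Prop, [/\ is_submod C, forall x, C x -> B x -> x = 0 &
    forall x, x <> 0 -> exists r b c,
      [/\ B b, C c, r *: x = b + c & r *: x <> 0]].
Proof.
move=> submodB.
have [|//|C [submodC _ CB Cmax]] := @maximal_disjoint (fun x => x = 0) B.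
  by split=> [//|a u v -> ->]; rewrite scaler0 addr0.
exists C; split=> // x x0; apply: contrapT => nx.
have Cx : C x.
  apply: (Cmax (fun y => exists c r, C c /\ y = c + r *: x)).
  - split=> [|a u v [c [r [Cc ->]]] [d [s [Cd ->]]]].
      by exists 0, 0; rewrite scale0r addr0; split=> //; exact: submodC.1.
    exists (a *: c + d), (a * r + s); split; first exact: submodC.2.
    by rewrite scalerDr scalerA addrACA scalerDl.
  - by move=> y Cy; exists y, 0; rewrite scale0r addr0.
  - move=> y [c [r [Cc ->]]] Bcr.
    have [rx|rx] := EM (r *: x = 0).
      by apply: CB => //; rewrite rx addr0.
    exfalso; apply: nx; exists r, (c + r *: x), (- c); split=> //.
      by rewrite -scaleN1r; apply: is_submodZ.
    by rewrite addrAC subrr add0r.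
  - by exists 0, 1; rewrite add0r scale1r; split=> //; exact: submodC.1.
apply: nx; exists 1, 0, x; rewrite scale1r add0r; split=> //; exact: submodB.1.
Qed.

End Zorn.

(** * Baer's criterion and hereditary rings *)

Section Baer.
Context (R : pzRingType).

(** Partial extensions are encoded by their graphs, the submodules of [M * V] that meet the second
    factor in zero; a maximal one is defined everywhere. *)
Lemma Baer (V : lmodType R) :
  (forall (L : submodClosed R^o) (f : {linear submod L -> V}),
    exists v : V, forall x : submod L, f x = (val x : R) *: v) ->
  injective_module V.
Proof.
move=> baerV A M g f ginj.
pose G (p : (M * V)%type) := exists a, p = (g a, f a).
pose Z (p : (M * V)%type) := p.1 = 0.
have submodG : is_submod G.
  split=> [|a u v [x ->] [y ->]]; first by exists 0; rewrite !linear0.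
  by exists (a *: x + y); rewrite !linearP.
have GZ p : G p -> Z p -> p = 0.
  move=> [a ->]; rewrite /Z /= => ga0.
  have a0 : a = 0 by apply: ginj; rewrite ga0 linear0.
  by rewrite a0 !linear0.
have [C [submodC GC CZ Cmax]] := maximal_disjoint submodG GZ.
have Cfun m v w : C (m, v) -> C (m, w) -> v = w.
  move=> Cv Cw; have := CZ _ (is_submodB submodC Cv Cw).
  by move=> /(_ (subrr m))/(congr1 snd)/eqP; rewrite subr_eq0 => /eqP.
have Cdom m : exists v, C (m, v).
  (* The left ideal of scalars moving [m] into the domain. The map on it is multiplication by some
     [v], so [(m, v)] can be added to the graph. *)
  pose D (r : R^o) := exists v, C ((r : R) *: m, v).
  have submodD : is_submod D.
    split=> [|a u v [x Cx] [y Cy]].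
      by exists 0; rewrite scale0r; exact: submodC.1.
    exists (a *: x + y).
    by have := submodC.2 a _ _ Cx Cy; rewrite /D scalerDl -scalerA.
  have Dval (x : submod (mksub submodD)) : D (val x).
    exact/(in_mksub submodD)/valP.
  have [f' f'E] := choice Dval.
  have f'lin : linear f'.
    move=> a u v; apply: Cfun (f'E _) _.
    have -> : (val (a *: u + v) : R) *: m =
        a *: ((val u : R) *: m) + (val v : R) *: m.
      by rewrite scalerA -scalerDl.
    exact: (submodC.2 a _ _ (f'E u) (f'E v)).
  have [v vE] := baerV _ (mklin f'lin).
  exists v.
  apply: (Cmax (fun p => exists q r, C q /\ p = q + r *: (m, v))).
  - split=> [|a u w [c [r [Cc ->]]] [d [s [Cd ->]]]].
      by exists 0, 0; rewrite scale0r addr0; split=> //; exact: submodC.1.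
    exists (a *: c + d), (a * r + s); split; first exact: submodC.2.
    by rewrite scalerDr scalerA addrACA scalerDl.
  - by move=> y Cy; exists y, 0; rewrite scale0r addr0.
  - move=> _ [[n w] [r [Cq ->]]]; rewrite /Z /= => /eqP.
    rewrite addr_eq0 => /eqP nE; subst n.
    have Cr : C (r *: m, - w).
      have := is_submodZ submodC (- 1) Cq.
      by congr C; congr pair; rewrite /= scaleN1r ?opprK.
    have Dr : (r : R^o) \in mksub submodD by apply/in_mksub; exists (- w).
    pose x0 : submod (mksub submodD) := Sub r Dr.
    have f'x0 : f' x0 = - w by exact: (Cfun (r *: m) _ _ (f'E x0) Cr).
    have rv : r *: v = - w by rewrite -f'x0 -[f' x0]/(mklin f'lin x0) vE.
    by congr pair; rewrite /= ?addNr// rv subrr.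
  - by exists 0, 1; rewrite add0r scale1r; split=> //; exact: submodC.1.
have [h hE] := choice Cdom.
have hlin : linear h.
  by move=> a u v; apply: Cfun (hE _) _; exact: (submodC.2 a _ _ (hE u) (hE v)).
exists (mklin hlin) => a; apply: Cfun (hE _) _; apply: GC; by exists a.
Qed.

(** A map from a left ideal to [V] lifts to [E] because the ideal is projective, and the lift
    extends to [R]; this is Baer's criterion. *)
Lemma injective_quotient (E V : lmodType R) (p : {linear E -> V}) :
  left_hereditary R -> injective_module E -> (forall v, exists e, p e = v) ->
  injective_module V.
Proof.
move=> hered injE psurj; apply: Baer => L f.
have [g gE] := hered L _ _ p f psurj.
have [h hE] := injE _ _ (val : {linear submod L -> R^o}) g val_inj.
exists (p (h 1)) => x.
by rewrite -gE -hE linear_smul linearZ.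
Qed.

(** Induction on [s]: the image of the first functional is a left ideal, hence projective, so its
    kernel splits off, and the remaining functionals separate the points of that kernel. *)
Lemma finite_torsionless_projective (I : eqType) (s : seq I)
    (M : lmodType R) (phi : I -> {linear M -> R^o}) :
  left_hereditary R ->
  (forall x, (forall i, i \in s -> phi i x = 0) -> x = 0) ->
  projective_module M.
Proof.
move=> hered; elim: s M phi => [|i0 s IHs] M phi inj.
  move=> A B g h gsurj.
  have zlin : linear (fun _ : M => 0 : A) by move=> a u v; rewrite scaler0 addr0.
  by exists (mklin zlin) => p; rewrite (inj p)//= !linear0.
pose f := phi i0; pose K := mksub (is_submod_ker f).
have projK : projective_module (submod K).
  pose res i : {linear submod K -> R^o} :=
    lin_comp (phi i) (val : {linear submod K -> M}).
  apply: (IHs (submod K) res) => x xs; apply/val_inj/inj => i.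
  rewrite inE => /orP[/eqP ->|si]; last exact: (xs i si).
  exact/(in_mksub (is_submod_ker f))/valP.
pose J := mksub (is_submod_image f).
have imP x : f x \in J by apply/in_mksub; exists x.
pose fI x : submod J := Sub (f x) (imP x).
have fIlin : linear fI by move=> a u v; apply: val_inj; rewrite /= linearP.
have fIsurj (y : submod J) : exists x, mklin fIlin x = y.
  have [x xE] := (in_mksub (is_submod_image f) (val y)).1 (valP y).
  by exists x; apply: val_inj.
have [sg sgE] := hered J _ _ (mklin fIlin) (lin_id (submod J)) fIsurj.
have kP x : x - sg (fI x) \in K.
  apply/in_mksub; rewrite linearB /=.
  by have := congr1 val (sgE (fI x)) => /= ->; rewrite subrr.
pose k x : submod K := Sub (x - sg (fI x)) (kP x).
have klin : linear k.
  move=> a u v; apply: val_inj; rewrite /= fIlin linearP.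
  by rewrite scalerBr opprD addrACA.
pose i (x : M) : (submod J * submod K)%type := (fI x, k x).
have ilin : linear i by move=> a u v; rewrite /i fIlin klin.
pose r (p : (submod J * submod K)%type) := sg p.1 + val p.2.
have rlin : linear r.
  by move=> a u v; rewrite /r /= !linearP /= scalerDr addrACA.
apply: (projective_retract (i := mklin ilin) (r := mklin rlin)) => [x|].
  by rewrite /= /r /= addrC subrK.
move=> A B g h gsurj.
have l1 : linear (fun x : submod J => (x, 0) : (submod J * submod K)%type).
  by move=> a u v; congr pair => //=; rewrite scaler0 addr0.
have l2 : linear (fun x : submod K => (0, x) : (submod J * submod K)%type).
  by move=> a u v; congr pair => //=; rewrite scaler0 addr0.
have [h1 h1E] := hered J _ _ g (lin_comp h (mklin l1)) gsurj.
have [h2 h2E] := projK _ _ g (lin_comp h (mklin l2)) gsurj.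
have hlin : linear (fun p : (submod J * submod K)%type => h1 p.1 + h2 p.2).
  by move=> a u v; rewrite /= !linearP scalerDr addrACA.
exists (mklin hlin) => -[x y] /=; rewrite linearD h1E h2E /= -linearD.
by congr (h _); congr pair; rewrite ?addr0 ?add0r.
Qed.

End Baer.

(** * The injective envelope of a left hereditary ring *)

Section Span.
Context (R : pzRingType) (V : lmodType R).

Fixpoint lspan (l : seq V) (x : V) : Prop :=
  if l is v :: l' then exists r : R, lspan l' (x - r *: v) else x = 0.

Lemma is_submod_lspan l : is_submod (lspan l).
Proof.
elim: l => [|v l [IH0 IHD]] /=; first by split=> // a u w -> ->; rewrite scaler0 addr0.
split=> [|a u w [r ur] [s ws]]; first by exists 0; rewrite scale0r subr0.
exists (a * r + s); have := IHD a _ _ ur ws.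
by rewrite scalerBr addrACA -opprD scalerA -scalerDl.
Qed.

Lemma lspan_min (P : V -> Prop) l x : is_submod P ->
  (forall v, v \in l -> P v) -> lspan l x -> P x.
Proof.
move=> submodP; elim: l x => [|v l IHl] x lP /=.
  by move=> ->; exact: submodP.1.
move=> [r xr]; rewrite -(subrK (r *: v) x); apply: is_submodD => //.
  by apply: IHl => // w wl; apply: lP; rewrite inE wl orbT.
by apply: is_submodZ => //; apply: lP; rewrite inE eqxx.
Qed.

Lemma lspan_cons v l x : lspan l x -> lspan (v :: l) x.
Proof. by move=> lx; exists 0; rewrite scale0r subr0. Qed.

Lemma lspan_mem l v : v \in l -> lspan l v.
Proof.
elim: l => // w l IHl; rewrite inE => /orP[/eqP ->|/IHl]; last exact: lspan_cons.
by exists 1; rewrite scale1r subrr; exact: (is_submod_lspan l).1.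
Qed.

Lemma lspan_sub l l' x : {subset l <= l'} -> lspan l x -> lspan l' x.
Proof.
by move=> ll'; apply: lspan_min (is_submod_lspan _) _ => v /ll'; exact: lspan_mem.
Qed.

Lemma lspan1 v x : lspan [:: v] x <-> exists r : R, x = r *: v.
Proof.
split=> [[r /eqP]|[r ->]]; first by rewrite subr_eq0 => /eqP; exists r.
by exists r; rewrite /= subrr.
Qed.

End Span.

(** * Annihilators and nonsingularity *)

Section Idempotent.
Context (R : pzRingType).

(* When [R m] is projective the annihilator of [m] is that of an idempotent. *)
Lemma cyclic_projective (M : lmodType R) (m : M) :
  projective_module (submod (mksub (is_submod_image (smul m)))) ->
  exists e : R, e *: m = m /\ forall r : R, r *: m = 0 -> r * e = 0.
Proof.
set I := mksub _ => projI.
have imP r : smul m r \in I by apply/in_mksub; exists r.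
pose f r : submod I := Sub (smul m r) (imP r).
have flin : linear f by move=> a u v; apply: val_inj; rewrite /= scalerDl scalerA.
have fsurj (y : submod I) : exists x, mklin flin x = y.
  have [x xE] := (in_mksub (is_submod_image (smul m)) (val y)).1 (valP y).
  by exists x; apply: val_inj.
have [s sE] := projI _ _ (mklin flin) (lin_id (submod I)) fsurj.
exists (s (f 1)); split.
  by have /(congr1 val)/= := sE (f 1); rewrite scale1r.
move=> r rm; rewrite -[LHS]/(r *: s (f 1)) -linearZ.
have -> : r *: f 1 = 0 by apply: val_inj; rewrite /= scale1r.
by rewrite linear0.
Qed.

(** Let [e] be the idempotent of [a]. If [e] were nonzero, some nonzero [s * e] would lie in [K] and
    kill [a]; then [s * a = 0], which forces [s * e = 0]. *)
Lemma hereditary_nonsingular (K : R -> Prop) (a : R) : left_hereditary R ->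
  (forall r, r <> 0 -> exists s, K (s * r) /\ s * r <> 0) ->
  (forall r, K r -> r * a = 0) -> a = 0.
Proof.
move=> hered Kess Ka.
have [e [ea eann]] := cyclic_projective (m := a : R^o) (hered _).
have [e0|/Kess[s [/Ka sea nse]]] := EM (e = 0); first by rewrite -ea e0 scale0r.
exfalso; apply: nse; apply: eann.
by move: sea; rewrite -mulrA -[e * a]/(e *: (a : R^o)) ea.
Qed.

End Idempotent.

(** * Essential submodules and finite generation *)

Section Essential.
Context (R : pzRingType) (hered : left_hereditary R).
Context (E : lmodType R) (iota : {linear R^o -> E}).
Context (envE : injective_envelope iota).

Lemma iota_inj : injective iota. Proof. by case: envE. Qed.

Lemma injE : injective_module E. Proof. by case: envE. Qed.

Lemma essentialP (x : E) : x <> 0 ->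
  exists (r : R) (a : R^o), iota a = r *: x /\ r *: x <> 0.
Proof.
move=> x0; apply: contrapT => nx; apply: x0.
case: envE => _ _ /(_ (mksub (is_submod_lspan [:: x]))); apply.
  move=> a /in_mksub/lspan1[r rE]; apply: contrapT => ia.
  by apply: nx; exists r, a; rewrite rE in ia *.
by apply/in_mksub/lspan_mem; rewrite inE.
Qed.

(** If [r *: y] were a nonzero element [iota a], the scalars [s] with [s * r] in [K] would be
    essential in [R] and kill [a]. *)
Lemma nonsingular (K : R -> Prop) (y : E) : K 0 ->
  (forall r, r <> 0 -> exists s, K (s * r) /\ s * r <> 0) ->
  (forall r, K r -> r *: y = 0) -> y = 0.
Proof.
move=> K0 Kess Ky; apply: contrapT => /essentialP[r [a [ra ry]]].
apply: ry; rewrite -ra.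
suff -> : a = 0 by rewrite linear0.
apply: (@hereditary_nonsingular R (fun s => K (s * r))) => // [u u0|s /Ky].
  have [ur|/Kess[s [Ks sur]]] := EM (u * r = 0).
    by exists 1; rewrite !mul1r ur.
  exists s; rewrite -mulrA; split=> // su; apply: sur.
  by rewrite mulrA su mul0r.
rewrite -scalerA -ra -linearZ /= => sra.
by apply: iota_inj; rewrite linear0 -[RHS]sra.
Qed.

Definition ess_in (M : lmodType R) (A S : M -> Prop) : Prop :=
  forall x, S x -> x <> 0 -> exists r : R, A (r *: x) /\ r *: x <> 0.

(** The scalars moving [x] into [A] are essential in [R] and kill [h x]. *)
Lemma ess_in_ker (M : lmodType R) (A : M -> Prop) (h : {linear M -> E}) :
  A 0 -> ess_in A (fun=> True) -> (forall x, A x -> h x = 0) ->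
  forall x, h x = 0.
Proof.
move=> A0 Aess hA x; apply: (@nonsingular (fun r => A (r *: x))).
- by rewrite scale0r.
- move=> r r0; have [rx|/Aess[//|s [As sx]]] := EM (r *: x = 0).
    by exists 1; rewrite mul1r rx.
  exists s; rewrite -scalerA; split=> // sr; apply: sx.
  by rewrite scalerA sr scale0r.
- by move=> r Ar; rewrite -linearZ /= hA.
Qed.

Lemma iota_ess : ess_in (fun x => exists a, iota a = x) (fun=> True).
Proof.
by move=> x _ /essentialP[r [a [ra rx]]]; exists r; split=> //; exists a.
Qed.

(** This is why the maximal quotient ring fills the whole of [E]. *)
Lemma iota_ker (h : {linear E -> E}) : (forall a, h (iota a) = 0) ->
  forall x, h x = 0.
Proof.
move=> h0; apply: ess_in_ker iota_ess _; first by exists 0; rewrite linear0.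
by move=> _ [a <-].
Qed.

Section Projective.
Context (projE : projective_module E).

(** All but finitely many functionals of a dual basis vanish on [A], hence on its essential span,
    hence everywhere, because [R^o] embeds in [E]. *)
Lemma finite_dual_basis (M : lmodType R) (A : seq M) :
  projective_module M -> ess_in (lspan A) (fun=> True) ->
  exists (I : choiceType) (m : I -> M) (phi : I -> {linear M -> R^o})
      (s : seq I), uniq s /\ forall x, x = \sum_(i <- s) (phi i x : R) *: m i.
Proof.
move=> projM Aess; have [phi phiP] := projective_dual_basis projM.
have [t tP] : exists t : seq M, forall i, i \notin t -> forall v, v \in A ->
    phi i v = 0.
  elim: A {Aess} => [|v A [t tP]]; first by exists [::].
  have [[s sP] _] := phiP v; exists (s ++ t) => i.
  rewrite mem_cat => /norP[/sP iv /tP iA] w; rewrite inE => /orP[/eqP ->//|].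
  exact: iA.
exists M, id, phi, (undup t); split=> [|x]; first exact: undup_uniq.
apply: (phiP x).2 => [|i]; first exact: undup_uniq.
rewrite mem_undup => /tP iA; apply: iota_inj; rewrite linear0.
apply: (ess_in_ker (h := lin_comp iota (phi i)) _ Aess) => [|y Ay /=].
  exact: (is_submod_lspan A).1.
have -> : phi i y = 0; last by rewrite linear0.
exact: (lspan_min (is_submod_ker (phi i)) iA Ay).
Qed.

Lemma E_dual_basis :
  exists (I : choiceType) (m : I -> E) (phi : I -> {linear E -> R^o})
      (s : seq I), uniq s /\ forall x, x = \sum_(i <- s) (phi i x : R) *: m i.
Proof.
apply: (@finite_dual_basis E [:: iota 1]) => // x xT x0.
have [r [[a ra] rx]] := iota_ess xT x0.
by exists r; split=> //; apply/lspan1; exists a; rewrite -ra linear_smul.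
Qed.

Lemma submodE_projective (S : submodClosed E) : projective_module (submod S).
Proof.
have [I [m [phi [s [_ sP]]]]] := E_dual_basis.
apply: (@finite_torsionless_projective R I s _
  (fun i => lin_comp (phi i) (val : {linear submod S -> E}))) => // x x0.
apply: val_inj; rewrite [LHS]sP big1_seq// => i /andP[_ /x0 /= ->].
by rewrite scale0r.
Qed.

Lemma E_finite : exists l : seq E, forall x, lspan l x.
Proof.
have [I [m [phi [s [_ sP]]]]] := E_dual_basis.
exists (map m s) => x; rewrite [x]sP big_seq.
have submodP := is_submod_lspan (map m s).
elim/big_rec: _ => [|i y si]; first exact: submodP.1.
by apply: submodP.2; apply: lspan_mem; exact: map_f.
Qed.

Lemma E_idempotent (y : E) :
  exists e : R, e *: y = y /\ forall r : R, r *: y = 0 -> r * e = 0.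
Proof. by apply: cyclic_projective; exact: submodE_projective. Qed.

Lemma fg_of_ess (S : E -> Prop) (l : seq E) : is_submod S ->
  (forall v, v \in l -> S v) -> ess_in (lspan l) S ->
  exists l', (forall v, v \in l' -> S v) /\ forall x, S x -> lspan l' x.
Proof.
move=> submodS lS less; pose T := submod (mksub submodS).
have valS (x : T) : S (val x) by exact/(in_mksub submodS)/valP.
pose toT x (Sx : S x) : T := Sub x ((in_mksub submodS x).2 Sx).
have [t tP] : exists t : seq T, map val t = l.
  elim: l lS {less} => [|v l IHl] lS; first by exists [::].
  have [w wl|t <-] := IHl; first by apply: lS; rewrite inE wl orbT.
  have Sv : S v by apply: lS; rewrite inE eqxx.
  by exists (toT v Sv :: t).
have spanT (s : seq T) (x : T) : lspan s x <-> lspan (map val s) (val x).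
  elim: s x => [|v s IHs] x /=; first by split=> [->//|x0]; apply: val_inj.
  by split=> -[r]; [move/IHs|move=> xr]; exists r => //; apply/IHs.
have [|I [m [phi [s [_ sP]]]]] := @finite_dual_basis T t (@submodE_projective (mksub submodS)).
  move=> x _ x0.
  have [|r [rl rx]] := less _ (valS x).
    by move=> vx; apply: x0; apply: val_inj.
  exists r; split; first by apply/spanT; rewrite tP.
  by move=> rx0; apply: rx; have := congr1 val rx0.
exists (map val (map m s)); split=> [_ /mapP[x _ ->]//|x Sx].
rewrite -[x]/(val (toT x Sx)); apply/spanT; rewrite [toT _ _]sP big_seq.
have submodP := is_submod_lspan (map m s).
elim/big_rec: _ => [|i y si]; first exact: submodP.1.
by apply: submodP.2; apply: lspan_mem; exact: map_f.
Qed.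

End Projective.

End Essential.

(** * Noetherian modules *)

Section NoetherianModules.
Context (R : pzRingType).

Definition noetherian_module (M : lmodType R) : Prop :=
  forall S : M -> Prop, is_submod S ->
    exists l : seq M, (forall v, v \in l -> S v) /\ forall x, S x -> lspan l x.

Lemma noetherian_embed (M N : lmodType R) (f : {linear M -> N}) :
  injective f -> noetherian_module N -> noetherian_module M.
Proof.
move=> finj noethN S submodS.
pose T y := exists x, S x /\ f x = y.
have submodT : is_submod T.
  split=> [|a _ _ [x [Sx <-]] [y [Sy <-]]].
    by exists 0; rewrite linear0; split=> //; exact: submodS.1.
  by exists (a *: x + y); rewrite linearP; split=> //; exact: submodS.2.
have [l [lT Tl]] := noethN T submodT.
have [k [kS kl]] : exists k : seq M, (forall v, v \in k -> S v) /\ map f k = l.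
  elim: l lT {Tl} => [|z l IHl] lT; first by exists [::].
  have [w wl|k [kS kl]] := IHl; first by apply: lT; rewrite inE wl orbT.
  have [x [Sx fx]] := lT _ (mem_head _ _).
  exists (x :: k); split=> [v|]; last by rewrite /= fx kl.
  by rewrite inE => /orP[/eqP ->//|/kS].
exists k; split=> // x Sx.
have {Sx} : lspan l (f x) by apply: Tl; exists x.
rewrite -kl; elim: k x {kS kl} => [|v k IHk] x /=.
  by move=> fx; apply: finj; rewrite linear0.
by move=> [r]; rewrite -linearZ -linearB => /IHk; exists r.
Qed.

Lemma noetherian_chain (M : lmodType R) (F : nat -> M -> Prop) :
  noetherian_module M -> (forall n, is_submod (F n)) ->
  (forall n x, F n x -> F n.+1 x) -> exists n, forall x, F n.+1 x -> F n x.
Proof.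
move=> noethM submodF Fincr.
have Fle m n x : (m <= n)%N -> F m x -> F n x.
  by move=> /subnK <-; elim: (n - m)%N => // k IHk /IHk; exact: Fincr.
pose U x := exists n, F n x.
have submodU : is_submod U.
  split=> [|a u v [m Fu] [n Fv]]; first by exists 0%N; exact: (submodF 0%N).1.
  exists (maxn m n); apply: (submodF _).2.
    exact: Fle (leq_maxl m n) Fu.
  exact: Fle (leq_maxr m n) Fv.
have [l [lU Ul]] := noethM U submodU.
have [n nl] : exists n, forall v, v \in l -> F n v.
  elim: l lU {Ul} => [|v l IHl] lU; first by exists 0%N.
  have [w wl|n nl] := IHl; first by apply: lU; rewrite inE wl orbT.
  have [m Fm] := lU v (mem_head _ _).
  exists (maxn m n) => w; rewrite inE => /orP[/eqP ->|/nl].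
    exact: Fle (leq_maxl m n) Fm.
  exact: Fle (leq_maxr m n).
exists n => x Fx; apply: (lspan_min (submodF n) nl); apply: Ul.
by exists n.+1.
Qed.

(** Indexing the family lets a maximal submodule come with its index, such as the element of which
    it is the annihilator. *)
Lemma noetherian_max (M : lmodType R) (T : Type) (P : T -> Prop)
    (F : T -> M -> Prop) : noetherian_module M ->
  (forall t, is_submod (F t)) -> (exists t, P t) ->
  exists t, P t /\ forall t', P t' -> (forall x, F t x -> F t' x) ->
    forall x, F t' x -> F t x.
Proof.
move=> noethM submodF [t0 Pt0]; apply: contrapT => nmax.
have /choice[next nextP] t : exists t', P t -> [/\ P t',
    forall x, F t x -> F t' x & exists x, F t' x /\ ~ F t x].
  have [Pt|Pt] := EM (P t); last by exists t.
  apply: contrapT => nt; apply: nmax; exists t; split=> // t' Pt' tt' x Fx.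
  apply: contrapT => nFx; apply: nt; exists t' => _; split=> //.
  by exists x.
pose c n := iter n next t0.
have Pc n : P (c n) by elim: n => // n /nextP[].
have [n nP] := noetherian_chain (F := fun n => F (c n)) noethM
  (fun n => submodF (c n)) (fun n x => let: And3 _ h _ := nextP _ (Pc n) in h x).
by have [_ _ [x [/nP]]] := nextP _ (Pc n).
Qed.

(** By injectivity of [V], each coordinate of a map from a left ideal is multiplication by an
    element. As the ideal is finitely generated, all but finitely many of these elements can be
    replaced by zero. *)
Lemma injective_dsum (I : choiceType) (V : lmodType R) :
  noetherian_module (R^o : lmodType R) -> injective_module V ->
  injective_module (dsum I V).
Proof.
move=> noethR injV; apply: Baer => L f.
have /choice[y yE] (i : I) : exists y : V, forall x : submod L,
    dval (f x) i = (val x : R) *: y.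
  have [h hE] := injV _ _ (val : {linear submod L -> R^o})
    (lin_comp (dcoord V i) f) val_inj.
  by exists (h 1) => x; rewrite -[LHS]hE linear_smul.
have [l [lL Ll]] := noethR _ (submodClosedP L).
have [s sP] : exists s : seq I, forall i, i \notin s -> forall v, v \in l ->
    (v : R) *: y i = 0.
  elim: l lL {Ll} => [|v l IHl] lL; first by exists [::].
  have [w wl|s sP] := IHl; first by apply: lL; rewrite inE wl orbT.
  pose v' : submod L := Sub v (lL v (mem_head _ _)).
  exists (dsupp (f v') ++ s) => i; rewrite mem_cat => /norP[iv /sP il] w.
  by rewrite inE => /orP[/eqP ->|/il//]; rewrite -[v]/(val v') -yE dsuppP.
exists (mkdsum s y) => x; apply: dval_inj => i.
rewrite dvalZ dval_mkdsum yE; case: ifPn => // /sP iy; rewrite scaler0.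
apply: (lspan_min (is_submod_ker (smul (y i))) iy); exact: Ll (valP x).
Qed.

End NoetherianModules.

(** * Independent sequences in the envelope *)

Section Noetherian.
Context (R : pzRingType) (hered : left_hereditary R).
Context (E : lmodType R) (iota : {linear R^o -> E}).
Context (envE : injective_envelope iota) (projE : projective_module E).

Section Independent.
Context (v : nat -> E).
Context (v_indep : forall n (r : R), lspan (mkseq v n) (r *: v n) -> r *: v n = 0).

Lemma independent_sum (c : nat -> R) n :
  \sum_(i < n) c i *: v i = 0 -> forall i, (i < n)%N -> c i *: v i = 0.
Proof.
elim: n => // n IHn; rewrite big_ord_recr /= => cn.
have vn0 : c n *: v n = 0.
  apply: v_indep; move/eqP: cn; rewrite addrC addr_eq0 => /eqP ->.
  have submodP := is_submod_lspan (mkseq v n).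
  rewrite -scaleN1r; apply: is_submodZ => //.
  apply: is_submod_sum => // i; apply: is_submodZ => //; apply: lspan_mem.
  by apply/mapP; exists (val i) => //; rewrite mem_iota /=.
move=> i; rewrite ltnS leq_eqVlt => /orP[/eqP ->//|]; apply: IHn.
by move: cn; rewrite vn0 addr0.
Qed.

Let S (A : nat -> bool) : {linear dsum nat R^o -> E} :=
  dsum_lin (fun i => smul (if A i then v i else 0)).

Lemma independent_dsum (f : dsum nat R^o) : S xpredT f = 0 ->
  forall i, (dval f i : R) *: v i = 0.
Proof.
move=> Sf i; pose n := (\max_(j <- i :: dsupp f) j).+1.
have lt_n j : j \in i :: dsupp f -> (j < n)%N.
  by move=> jf; rewrite ltnS; exact: (leq_bigmax_seq (F := id)).
have fn j : j \notin seq.iota 0 n -> dval f j = 0.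
  move=> jn; apply: dsuppP; apply: contra jn => jf.
  by rewrite mem_iota lt_n// inE jf orbT.
apply: (@independent_sum (dval f) n); last by rewrite lt_n// inE eqxx.
rewrite -(big_mkord xpredT (fun j => (dval f j : R) *: v j)) /index_iota subn0.
rewrite -[RHS]Sf /S (dsum_lin_seq _ (iota_uniq 0 n) fn); exact: eq_bigr.
Qed.

(* The truncations [v n |-> if A n then v n else 0] extend to [E]; killing a
   complement of the span of [v] makes them commuting idempotents. *)
Lemma truncations : exists y : (nat -> bool) -> {linear E -> E},
  (forall (A : nat -> bool) n, y A (v n) = if A n then v n else 0) /\
  (forall (A : nat -> bool) (h : {linear E -> E}), (forall n, A n -> h (v n) = 0) ->
    forall x, h (y A x) = 0).
Proof.
have submodB := is_submod_image (S xpredT).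
have [C [submodC CB Cess]] := essential_complement submodB.
have Cin (c : submod (mksub submodC)) : C (val c).
  exact/(in_mksub submodC)/valP.
pose F := (dsum nat R^o * submod (mksub submodC))%type.
have allin : linear (fun p : F => S xpredT p.1 + val p.2).
  by move=> a p q; rewrite /= !linearP scalerDr addrACA.
have belin A : linear (fun p : F => S A p.1).
  by move=> a p q; rewrite /= !linearP.
(* The sum map need not be injective, since the [v i] may have annihilators. A relation only gives
   [c = 0] and that each coefficient kills its [v i], which is enough. *)
have ker A (p : F) : mklin allin p = 0 -> mklin (belin A) p = 0.
  case: p => f c /= /eqP; rewrite addr_eq0 => /eqP Sf.
  have c0 : val c = 0.
    apply: CB => //; exists (- f); rewrite linearN Sf opprK //.
  move: Sf; rewrite c0 oppr0 => /independent_dsum f0.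
  rewrite /S (dsum_lin_seq _ (dsupp_uniq f) (@dsuppP _ _ _ f)) big1// => i _.
  by rewrite smulE; case: (A i); rewrite ?f0 ?scaler0.
have /choice[y yE] (A : nat -> bool) := injective_factor (injE envE) (@ker A).
have yv A n : y A (v n) = if A n then v n else 0.
  have := yE A ((single n (1 : R^o), 0) : F); rewrite /= addr0 /S.
  by rewrite !dsum_lin_single !smulE !scale1r.
have yC A c : C c -> y A c = 0.
  move=> Cc; pose c' : submod (mksub submodC) := Sub c ((in_mksub submodC c).2 Cc).
  by have := yE A ((0, c') : F); rewrite /= !linear0 add0r.
exists y; split=> // A h hA x; rewrite -[h _]/(lin_comp h (y A) x).
apply: (ess_in_ker hered envE
  (A := fun x => exists b c, [/\ exists f, S xpredT f = b, C c & x = b + c])).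
- by exists 0, 0; rewrite addr0; split=> //; [exact: submodB.1|exact: submodC.1].
- move=> z _ /Cess[r [b [c [Bb Cc rz nrz]]]].
  by exists r; split=> //; exists b, c.
- move=> _ [_ [c [[f <-] Cc ->]]] /=; rewrite linearD (yC A c Cc) addr0.
  have -> : S xpredT f = \sum_(i <- dsupp f) (dval f i : R) *: v i.
    by rewrite /S (dsum_lin_seq _ (dsupp_uniq f) (@dsuppP _ _ _ f)).
  rewrite !linear_sum big1// => i _; rewrite !linearZ /= yv.
  by case: ifP => [/hA ->|_]; rewrite ?linear0 scaler0.
Qed.

End Independent.

(* The submodules attached to the sets [{(k, l) | l <= g k}], [g : nat -> nat],
   have a projective sum; since this sum contains a countable subset on which
   its functionals are determined, it would be generated by countably many of
   them, and a diagonal argument contradicts this. *)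
Lemma no_independent_sequence (v : nat -> E) :
  (forall n (r : R), lspan (mkseq v n) (r *: v n) -> r *: v n = 0) ->
  exists n, v n = 0.
Proof.
move=> v_indep; apply: contrapT => nv0.
have [y [yv yker]] := truncations v_indep.
pose Ag (g : nat -> nat) n :=
  if unpickle n is Some (k, l) then (l <= g k)%N else false.
pose Y g := y (Ag g).
pose T : {linear dsum (nat -> nat) E -> E} := dsum_lin Y.
pose J := mksub (is_submod_image T).
have TJ f : T f \in J by apply/in_mksub; exists f.
pose jT f : submod J := Sub (T f) (TJ f).
have [phi phiP] := projective_dual_basis (submodE_projective hered envE projE (S := J)).
(* If [n] encodes [(k, l)], then [v n] is fixed by the truncation of the constant function [l],
   which puts it in [J]. The default is for numbers encoding no pair; they lie in no [Ag g]. *)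
pose ln n := if unpickle n is Some p then (p : nat * nat).2 else 0.
pose u n := jT (single (fun=> ln n) (v n)).
have uE g n : Ag g n -> v n = val (u n).
  rewrite /= /T dsum_lin_single yv /Ag /ln.
  by case: unpickle => // -[k l] _; rewrite leqnn.
(* Extended to [E], the functional kills every [v n] with [n] in [Ag g], hence the image of
   [Y g]. *)
have phi0 i : (forall n, phi i (u n) = 0) -> forall x, phi i x = 0.
  move=> iu x.
  have [h hE] := injE envE (lin_comp iota (phi i))
    (g := (val : {linear submod J -> E})) val_inj.
  apply: (iota_inj envE); rewrite linear0 -[LHS]hE.
  have [f fE] := (in_mksub (is_submod_image T) (val x)).1 (valP x).
  transitivity (lin_comp h T f); first by rewrite /= fE.
  rewrite (dsum_lin_ext (h := mklin (_ : linear (fun=> 0 : E))))//.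
    by move=> a p q; rewrite scaler0 addr0.
  move=> _ g e /=; rewrite [T _]dsum_lin_single; apply: yker => n /uE ->.
  by rewrite hE /= iu linear0.
have /choice[s sP] n := (phiP (u n)).1.
have /choice[f fE] (i : submod J) : exists f, T f = val i.
  exact/(in_mksub (is_submod_image T))/valP.
pose gl n := flatten [seq dsupp (f i) | i <- s n].
(* The sum of the images of the [Y g], for [g] in the first lists [gl n], is handled through the
   endomorphisms that kill it. *)
pose killed N (h : {linear E -> E}) :=
  forall n g, (n <= N)%N -> g \in gl n -> forall e, h (Y g e) = 0.
have killedW N N' h : (N <= N')%N -> killed N' h -> killed N h.
  by move=> NN' hk n g nN; apply: hk; exact: leq_trans NN'.
have killedJ (x : submod J) : exists N, forall h, killed N h -> h (val x) = 0.
  have [t tP] := (phiP x).1.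
  rewrite ((phiP x).2 (undup t) (undup_uniq t)); last first.
    by move=> i; rewrite mem_undup; exact: tP.
  elim: (undup t) => [|i r [N NP]].
    by exists 0 => h _; rewrite big_nil linear0.
  have [n ni] : exists n, i \in s n \/ phi i x = 0.
    have [[n ni]|ni] := EM (exists n, i \in s n); first by exists n; left.
    exists 0; right; apply: phi0 => n; apply: sP; apply/negP => isn.
    by apply: ni; exists n.
  exists (maxn N n) => h hk; pose hv := lin_comp h (val : {linear submod J -> E}).
  rewrite big_cons -[LHS]/(hv _) linearD [X in _ + X]NP; last first.
    exact: killedW (leq_maxl N n) hk.
  rewrite addr0; case: ni => [ni|->]; last by rewrite scale0r linear0.
  rewrite linearZ /= -fE /T.
  rewrite (dsum_lin_seq _ (dsupp_uniq (f i)) (@dsuppP _ _ _ (f i))) linear_sum.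
  rewrite big1_seq ?scaler0// => g /andP[_ gi]; apply: hk (leq_maxr N n) _ _.
  by apply/flatten_mapP; exists i.
(* The diagonal function: at [k] it exceeds all functions listed in [gl n] with [n <= k]. *)
pose g k := (\sum_(n < k.+1) \sum_(g' <- gl n) g' k)%N.+1.
have g_gt n g' k : (n <= k)%N -> g' \in gl n -> (g' k < g k)%N.
  move=> nk g'n; rewrite ltnS (bigD1 (Ordinal (nk : (n < k.+1)%N)))//=.
  by apply: leq_trans (leq_addr _ _); rewrite (big_rem g')//= leq_addr.
have [l lE] := E_finite hered envE projE.
(* As [E] is finitely generated, one [N] serves for the whole image of [Y g]. *)
have [N NP] : exists N, forall h, killed N h -> forall e, e \in l -> h (Y g e) = 0.
  elim: l {lE} => [|e l [N NP]]; first by exists 0.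
  have [N' N'P] := killedJ (jT (single g e)).
  exists (maxn N N') => h hk e'; rewrite inE => /orP[/eqP ->|e'l].
    have := N'P h (killedW _ _ _ (leq_maxr N N') hk).
    by rewrite /= /T dsum_lin_single.
  exact: NP (killedW _ _ _ (leq_maxl N N') hk) _ e'l.
(* [n0] lies in [Ag g] but in no [Ag g'] with [g'] in a list [gl n], [n <= N]. Hence the truncation
   to [n0] alone kills the images of those [Y g'], and so that of [Y g], which contains [v n0]. *)
pose n0 := pickle (N, g N).
apply: nv0; exists n0.
have := yv (pred1 n0) n0; rewrite /= eqxx => <-.
have {1}-> : v n0 = Y g (v n0) by rewrite yv /Ag pickleK leqnn.
apply: (lspan_min (is_submod_ker (lin_comp (y (pred1 n0)) (Y g))) _ (lE (v n0))).
apply: NP => n g' nN g'n e; apply: yker => m; rewrite yv /= => mg'.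
case: eqP => // mn0; move: mg'; rewrite mn0 /Ag pickleK.
by rewrite leqNgt (g_gt n).
Qed.

(** By [fg_of_ess], no finite span inside a submodule that is not finitely generated is essential in
    it, so an independent sequence could be chosen step by step. *)
Lemma envelope_noetherian : noetherian_module E.
Proof.
move=> S submodS; apply: contrapT => nfg.
have /choice[next nextP] (l : seq E) : exists v : E, (forall w, w \in l -> S w) ->
    [/\ S v, v <> 0 & forall r : R, lspan l (r *: v) -> r *: v = 0].
  have [lS|lS] := EM (forall w, w \in l -> S w); last by exists 0.
  apply: contrapT => nv; apply: nfg.
  apply: (fg_of_ess hered envE projE submodS lS) => x Sx x0.
  apply: contrapT => nx; apply: nv; exists x => _; split=> // r rl.
  by apply: contrapT => rx; apply: nx; exists r.
pose L n := iter n (fun l => next l :: l) [::].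
have LS n : forall w, w \in L n -> S w.
  elim: n => // n IHn w; rewrite inE => /orP[/eqP ->|]; last exact: IHn.
  by case: (nextP _ IHn).
pose v n := next (L n).
have vL n : {subset mkseq v n <= L n}.
  move=> _ /mapP[i + ->]; rewrite mem_iota /= add0n.
  elim: n => // n IHn; rewrite ltnS leq_eqVlt inE => /orP[/eqP ->|/IHn ->].
    by rewrite eqxx.
  by rewrite orbT.
have [n vn0] : exists n, v n = 0.
  apply: no_independent_sequence => n r /(lspan_sub (vL n)).
  by case: (nextP _ (LS n)) => _ _; apply.
by case: (nextP _ (LS n)).
Qed.

End Noetherian.

(** * Simple submodules and the conductor *)

Section SimpleSubmodules.
Context (R : pzRingType) (hered : left_hereditary R).
Context (E : lmodType R) (iota : {linear R^o -> E}).
Context (envE : injective_envelope iota) (projE : projective_module E).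

Lemma noetherianR : noetherian_module (R^o : lmodType R).
Proof. exact: noetherian_embed (iota_inj envE) (envelope_noetherian hered envE projE). Qed.

(** Among nonzero multiples, first the annihilator of the cyclic submodule is made maximal, giving
    [y1], then that of the generator, giving [y]; the latter generates a simple submodule. *)
Lemma simple_submodule (x : E) : x <> 0 -> exists r : R, r *: x <> 0 /\
  forall s : R, s *: (r *: x) <> 0 -> exists t : R, t *: (s *: (r *: x)) = r *: x.
Proof.
move=> x0.
pose A (z : E) (r : R^o) := forall s : R, (r : R) *: (s *: z) = 0.
pose ann (z : E) (r : R^o) := (r : R) *: z = 0.
have submodA z : is_submod (A z).
  split=> [s|a u v Au Av s]; first by rewrite scale0r.
  by rewrite scalerDl Av addr0 -scalerA Au scaler0.
have submodann z : is_submod (ann z) by exact: (is_submod_ker (smul z)).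
have [|y1 [[y10 [r1 y1E]] y1max]] :=
  noetherian_max (P := fun z => z <> 0 /\ exists r : R, z = r *: x)
    noetherianR submodA.
  by exists x; split=> //; exists 1; rewrite scale1r.
have [|y [[y0 [r2 yE]] ymax]] :=
  noetherian_max (P := fun z => z <> 0 /\ exists r : R, z = r *: y1)
    noetherianR submodann.
  by exists y1; split=> //; exists 1; rewrite scale1r.
have AyE (s : R) : s *: y <> 0 -> forall r, A (s *: y) r -> A y r.
  move=> sy r Ar; have /(_ r Ar) Ar1 : forall r', A (s *: y) r' -> A y1 r'.
    apply: y1max; first by split=> //; exists (s * r2 * r1); rewrite yE y1E !scalerA.
    by move=> r' Ar' s'; rewrite yE !scalerA -!mulrA -scalerA.
  by move=> s'; rewrite yE (scalerA s').
(* With [e] the idempotent of [z], the multiple [e *: y] is nonzero and killed by all that kills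
   [z]; maximality is applied to it. *)
have yann (z : E) : z <> 0 -> (forall r, ann y r -> ann z r) ->
    forall r, ann z r -> ann y r.
  move=> z0 yz r rz.
  have [e [ez eann]] := E_idempotent hered envE projE z.
  apply: (ymax (e *: y)).
  - split; first by move=> /yz; rewrite /ann ez.
    by exists (e * r2); rewrite yE scalerA.
  - by move=> r' /yz/eann r'e; rewrite /ann scalerA r'e scale0r.
  - by rewrite /ann scalerA (eann r rz) scale0r.
exists (r2 * r1); rewrite -scalerA -y1E -yE; split=> // s sy.
have [e [ey eann]] := E_idempotent hered envE projE y.
(* Otherwise [e] would kill the cyclic submodule of [s *: y], hence that of [y] by [AyE], although
   [e] fixes [y]. *)
have [s' es'] : exists s' : R, e *: (s' *: (s *: y)) <> 0.
  apply: contrapT => ns; apply: y0; rewrite -ey -[y]scale1r.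
  apply: (AyE s sy e) => s'; apply: contrapT => es'; apply: ns.
  by exists s'.
pose c := e * s' * s; pose w := c *: y.
have wE : w = e *: (s' *: (s *: y)) by rewrite /w /c !scalerA.
have annw : forall r : R, r *: w = 0 -> r *: y = 0.
  apply: yann; first by rewrite wE.
  by move=> r /eann re; rewrite /ann wE scalerA re scale0r.
(* [psi] extends the inverse of the embedding that sends [y] to [w]; its iterates at [y] span an
   ascending chain. *)
have [psi psiE] := injective_factor (al := smul w) (be := smul y) (injE envE) annw.
have psiw : psi w = y by have := psiE 1; rewrite !smulE !scale1r.
pose ys n := iter n psi y.
have ysS n : c *: ys n.+1 = ys n.
  elim: n => [|n IHn]; first by rewrite /= -linearZ.
  by rewrite [in LHS]/ys iterS -linearZ IHn.
have ys0 n : ys n <> 0.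
  by elim: n => // n IHn yn; apply: IHn; rewrite -ysS yn scaler0.
have annys n (r : R) : r *: y = 0 -> r *: ys n = 0.
  by move=> ry; elim: n => // n IHn; rewrite /= -linearZ IHn linear0.
have [n nP] := noetherian_chain (F := fun n z => exists r : R, z = r *: ys n)
  (envelope_noetherian hered envE projE) (fun n => ltac:(split=> [|a _ _ [r ->] [r' ->]];
    [by exists 0; rewrite scale0r
    |by exists (a * r + r'); rewrite scalerDl scalerA]))
  ltac:(by move=> n _ [r ->]; exists (r * c); rewrite -scalerA ysS).
have [d dE] : exists d : R, ys n.+1 = d *: ys n.
  by apply: nP; exists 1; rewrite scale1r.
(* Once the chain stops, [1 - d * c] kills [ys n.+1], which has the same annihilator as [y]. So
   [y = (d * c) *: y], a multiple of [s *: y]. *)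
have /(yann _ (ys0 n.+1) (annys n.+1)) : ann (ys n.+1) (1 - d * c).
  by rewrite /ann scalerBl scale1r -scalerA ysS -dE subrr.
rewrite /ann scalerBl scale1r => /eqP; rewrite subr_eq0 => /eqP ydc.
by exists (d * (e * s')); rewrite scalerA [RHS]ydc /c !mulrA.
Qed.

(* the elements [t] of [R] with [t Q] contained in [R] *)
Definition conductor (t : R) : Prop := forall x : E, exists a, iota a = t *: x.

(** A generator [t] of a simple left ideal lies in the conductor: if [t *: q] is nonzero, some
    nonzero [s' *: (t *: q)] lies in [R], and simplicity recovers [t] from [s' * t]. *)
Lemma conductor_ess (x : E) : x <> 0 ->
  exists (r t : R), [/\ conductor t, iota t = r *: x & r *: x <> 0].
Proof.
move=> x0; have [s [a [ax sx]]] := essentialP envE x0.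
have [r [rsx simple]] := simple_submodule sx.
exists (r * s), (r * a : R); rewrite -scalerA -ax.
have raE : iota (r * a : R) = r *: iota a by rewrite -linearZ.
split=> //; last by rewrite ax.
move=> q; have [raq|raq] := EM ((r * a : R) *: q = 0).
  by exists 0; rewrite linear0.
have [s' [b [bE s'q]]] := essentialP envE raq.
have [|t tE] := simple s'.
  rewrite -ax -raE -linearZ => s'ra; apply: s'q.
  have s'ra0 : s' * (r * a : R) = 0.
    by apply: (iota_inj envE); rewrite linear0.
  by rewrite scalerA s'ra0 scale0r.
have tra : t * (s' * (r * a)) = r * a.
  by apply: (iota_inj envE); rewrite raE ax -[RHS]tE -ax -raE -!linearZ.
by exists (t * b); rewrite -tra -scalerA -(scalerA s') -bE -linearZ.
Qed.

(** [right_mul envE (iota t) u] is the product [u * t] in the quotient ring. *)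
Lemma conductor_dual_basis : exists (n : nat) (t : 'I_n -> R) (u : 'I_n -> E),
  (forall j, conductor (t j)) /\
  iota 1 = \sum_j right_mul envE (iota (t j)) (u j).
Proof.
have submodT : is_submod (conductor : R^o -> Prop).
  split=> [x|a u v uT vT x]; first by exists 0; rewrite linear0 scale0r.
  have [[b bE] [d dE]] := (uT x, vT x).
  exists (a *: b + d); rewrite linearP bE dE scalerDl.
  by rewrite scalerA.
pose T := submod (mksub submodT).
pose F (t : T) : {linear E -> E} := right_mul envE (iota (val t)).
pose S := dsum_lin F.
pose J := mksub (is_submod_image S).
have SJ f : S f \in J by apply/in_mksub; exists f.
pose jS f : submod J := Sub (S f) (SJ f).
have jSlin : linear jS by move=> a u v; apply: val_inj; rewrite /= linearP.
have injJ : injective_module (submod J).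
  apply: (injective_quotient (p := mklin jSlin) hered).
    exact: injective_dsum noetherianR (injE envE).
  move=> y; have [f fE] := (in_mksub (is_submod_image S) (val y)).1 (valP y).
  by exists f; apply: val_inj.
have [rho rhoE] := injective_split (i := (val : {linear submod J -> E})) injJ val_inj.
have hlin : linear (fun x => val (rho x) - x).
  by move=> a u v; rewrite linearP /= scalerBr opprD addrACA.
(* The projection onto [J] fixes the conductor, which is essential, so it is the identity. *)
have h0 x : val (rho x) - x = 0.
  apply: (ess_in_ker (h := mklin hlin) hered envE
    (A := fun x => exists t, conductor t /\ iota t = x)).
  - by exists 0; rewrite linear0; split=> //; exact: submodT.1.
  - move=> z _ /conductor_ess[r [t [tT tz rz]]]; exists r; split=> //.
    by exists t.
  - move=> _ [t [tT <-]].
    pose t' : T := Sub (t : R^o) ((in_mksub submodT t).2 tT).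
    have itE : iota t = val (jS (single t' (iota 1))).
      by rewrite /= /S dsum_lin_single /F right_mulE scale1r.
    by rewrite /= itE rhoE subrr.
have [f fE] := (in_mksub (is_submod_image S) _).1 (valP (rho (iota 1))).
move/eqP: (h0 (iota 1)); rewrite subr_eq0 -fE => /eqP.
rewrite /S (dsum_lin_seq _ (dsupp_uniq f) (@dsuppP _ _ _ f)) big_tnth => <-.
exists (size (dsupp f)), (fun j => val (tnth (in_tuple (dsupp f)) j)),
  (fun j => dval f (tnth (in_tuple (dsupp f)) j)); split=> // j.
exact/(in_mksub submodT)/valP.
Qed.

End SimpleSubmodules.

(** * Modules over the maximal quotient ring *)

(* [c j q] is the element of [A] with [phi (c j q) = phi (t j) * q]; the maps
   [c j] and the elements [u j] form a dual basis of [B] as a right [A]-module. *)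
Definition conductor_basis (A B : pzRingType) (phi : {rmorphism A -> B}) (n : nat)
    (t : 'I_n -> A) (u : 'I_n -> B) (c : 'I_n -> B -> A) : Prop :=
  [/\ injective phi, forall j q, phi (c j q) = phi (t j) * q &
      \sum_j u j * phi (t j) = 1].

Section ConductorBasis.
Context (A B : pzRingType) (phi : {rmorphism A -> B}).
Context (n : nat) (t : 'I_n -> A) (u : 'I_n -> B) (c : 'I_n -> B -> A).
Context (basis : conductor_basis phi t u c).

Let phi_inj : injective phi. Proof. by case: basis. Qed.
Let cE j q : phi (c j q) = phi (t j) * q. Proof. by case: basis. Qed.
Let ut : \sum_j u j * phi (t j) = 1. Proof. by case: basis. Qed.

Lemma basis_decomp q : \sum_j u j * phi (c j q) = q.
Proof.
under eq_bigr do rewrite cE mulrA.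
by rewrite -mulr_suml ut mul1r.
Qed.

Lemma basisD j p q : c j (p + q) = c j p + c j q.
Proof. by apply: phi_inj; rewrite rmorphD !cE mulrDr. Qed.

Lemma basis_sum j (I : Type) (r : seq I) (F : I -> B) :
  c j (\sum_(i <- r) F i) = \sum_(i <- r) c j (F i).
Proof.
elim: r => [|i r IHr]; last by rewrite !big_cons basisD IHr.
by apply: phi_inj; rewrite !big_nil cE mulr0 rmorph0.
Qed.

Lemma basisZ j q a : c j (q * phi a) = c j q * a.
Proof. by apply: phi_inj; rewrite rmorphM !cE mulrA. Qed.

Lemma basis1 j : c j 1 = t j.
Proof. by apply: phi_inj; rewrite cE mulr1. Qed.

(** Expand [q] by [basis_decomp]. With [q * u l] in place of [q], the identity says that the
    matrices [(c j (b * u k))] multiply like the elements [b]. *)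
Lemma basisM j p q : \sum_k c j (p * u k) * c k q = c j (p * q).
Proof.
under eq_bigr do rewrite -basisZ cE -mulrA.
by rewrite -basis_sum -mulr_sumr; under eq_bigr do rewrite mulrA;
  rewrite -mulr_suml ut mul1r.
Qed.

(** A vector [y] is the sum of the [u j *: (phi (t j) *: y)], and [phi (t j) * b] comes from [A], so
    [h] commutes with it. *)
Lemma restr_linear_full (M N : lmodType B)
    (h : {linear restr phi M -> restr phi N}) b (x : M) :
  h (b *: x : M) = b *: (h x : N).
Proof.
have hZ a (y : M) : h (phi a *: y : M) = phi a *: (h y : N).
  exact: (linearZ_LR h a (y : restr phi M)).
have decomp (y : N) : y = \sum_j u j *: (phi (t j) *: y).
  under eq_bigr do rewrite scalerA.
  by rewrite -scaler_suml ut scale1r.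
rewrite [LHS]decomp [RHS]decomp; apply: eq_bigr => j _.
apply: (congr1 (fun z : N => u j *: z)).
by rewrite -hZ !scalerA -cE hZ.
Qed.

Lemma conductor_basis_projective :
  projective_module (R := A^c) (right_restr phi).
Proof.
move=> M N g f gsurj.
have /choice[m mE] (j : 'I_n) : exists x : M, g x = f (u j) by exact: gsurj.
have hlin : linear (fun q : right_restr phi => \sum_j (c j q : A^c) *: m j).
  move=> a p q; rewrite scaler_sumr -big_split; apply: eq_bigr => j _ /=.
  by rewrite scalerA -scalerDl; congr (_ *: _); rewrite basisD basisZ.
exists (mklin hlin) => q /=; rewrite linear_sum -[in RHS](basis_decomp q).
rewrite (linear_sum f); apply: eq_bigr => j _; rewrite linearZ mE.
by rewrite -linearZ.
Qed.

(* The extension of scalars of [M] along [phi], realised as the fixed points in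
   [M^n] of the idempotent matrix [c j (u k)]. *)
Section Twist.
Context (M : lmodType A).

Definition twist_pred : {pred 'I_n -> M} :=
  fun x => `[< forall j, \sum_k c j (u k) *: x k = x j >].

Lemma twist_predP x :
  reflect (forall j, \sum_k c j (u k) *: x k = x j) (x \in twist_pred).
Proof. exact: asboolP. Qed.

Fact twist_closed : zmod_closed twist_pred.
Proof.
split=> [|x y /twist_predP xE /twist_predP yE]; apply/twist_predP => j.
  by rewrite big1// => k _; rewrite scaler0.
rewrite -[RHS]/(x j - y j) -xE -yE -sumrB; apply: eq_bigr => k _.
by rewrite -scalerBr.
Qed.

HB.instance Definition _ :=
  GRing.isZmodClosed.Build ('I_n -> M) twist_pred twist_closed.

Definition twist_of of conductor_basis phi t u c : Type :=
  {x : 'I_n -> M | x \in twist_pred}.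
Local Notation twist := (twist_of basis).

HB.instance Definition _ := Choice.on twist.
HB.instance Definition _ := SubType.on twist.
HB.instance Definition _ := [SubChoice_isSubZmodule of twist by <:].

Definition twval (x : twist) : 'I_n -> M := val x.

Lemma twval_inj (x y : twist) : twval x =1 twval y -> x = y.
Proof. by move=> xy; apply/val_inj/funext. Qed.

Lemma twvalP (x : twist) j : \sum_k c j (u k) *: twval x k = twval x j.
Proof. exact: (twist_predP _ (valP x)). Qed.

Lemma twvalD (x y : twist) j : twval (x + y) j = twval x j + twval y j.
Proof. by []. Qed.

Definition mktwist (x : 'I_n -> M)
    (xP : forall j, \sum_k c j (u k) *: x k = x j) : twist :=
  Sub x (introT (twist_predP x) xP).

Lemma twval_mk x xP : twval (@mktwist x xP) = x. Proof. by []. Qed.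

(** [x] stands for the sum of the tensors of [u k] with [x k]; this is the action of [b] in these
    coordinates. *)
Definition twist_scale_fun b (x : 'I_n -> M) : 'I_n -> M :=
  fun j => \sum_k c j (b * u k) *: x k.

Lemma twist_scaleA b b' x j :
  twist_scale_fun b (twist_scale_fun b' x) j = twist_scale_fun (b * b') x j.
Proof.
rewrite /twist_scale_fun; under eq_bigr do rewrite scaler_sumr.
rewrite exchange_big /=; apply: eq_bigr => l _.
under eq_bigr do rewrite scalerA.
by rewrite -scaler_suml basisM mulrA.
Qed.

Fact twist_scale_subproof b (x : twist) j :
  \sum_k c j (u k) *: twist_scale_fun b (twval x) k =
  twist_scale_fun b (twval x) j.
Proof.
rewrite -[b in RHS]mul1r -twist_scaleA; apply: eq_bigr => k _.
by rewrite mul1r.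
Qed.

Definition twist_scale b x : twist := mktwist (twist_scale_subproof b x).

Fact twist_scaleA' b b' x :
  twist_scale b (twist_scale b' x) = twist_scale (b * b') x.
Proof. by apply: twval_inj => j; exact: twist_scaleA. Qed.

Fact twist_scale1 : left_id 1 twist_scale.
Proof.
move=> x; apply: twval_inj => j; rewrite -[RHS]twvalP.
by apply: eq_bigr => k _; rewrite mul1r.
Qed.

Fact twist_scaleDr : right_distributive twist_scale +%R.
Proof.
move=> b x y; apply: twval_inj => j.
rewrite twvalD !twval_mk /twist_scale_fun -big_split; apply: eq_bigr => k _.
by rewrite twvalD scalerDr.
Qed.

Fact twist_scaleDl x : {morph twist_scale^~ x : b b' / b + b'}.
Proof.
move=> b b'; apply: twval_inj => j.
rewrite twvalD !twval_mk /twist_scale_fun -big_split; apply: eq_bigr => k _.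
by rewrite mulrDl basisD scalerDl.
Qed.

HB.instance Definition _ := GRing.Zmodule_isLmodule.Build B twist
  twist_scaleA' twist_scale1 twist_scaleDr twist_scaleDl.

Lemma twvalZ b (x : twist) j :
  twval (b *: x) j = \sum_k c j (b * u k) *: twval x k.
Proof. by []. Qed.

Lemma twval_sum (I : Type) (r : seq I) (F : I -> twist) j :
  twval (\sum_(i <- r) F i) j = \sum_(i <- r) twval (F i) j.
Proof.
elim: r => [|i r IHr]; first by rewrite !big_nil.
by rewrite !big_cons twvalD IHr.
Qed.

Fact twist_eta_subproof (m : M) j :
  \sum_k c j (u k) *: (t k *: m) = t j *: m.
Proof.
under eq_bigr do rewrite scalerA -basisZ.
by rewrite -scaler_suml -basis_sum ut basis1.
Qed.

(** The coordinates of the tensor of [1] with [m], because [1] is the sum of the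
    [u j * phi (t j)]. *)
Definition twist_eta_fun (m : M) : restr phi twist :=
  mktwist (twist_eta_subproof m).

Lemma twval_eta m j : twval (twist_eta_fun m) j = t j *: m. Proof. by []. Qed.

Fact twist_eta_linear : linear twist_eta_fun.
Proof.
move=> a x y; apply: twval_inj => j.
rewrite twval_eta scalerDr scalerA.
transitivity (\sum_k c j (phi a * u k) *: (t k *: x) + t j *: y); last by [].
congr (_ + _); rewrite -basis1 -basisZ mul1r.
under [RHS]eq_bigr do rewrite scalerA -basisZ -mulrA.
by rewrite -scaler_suml -basis_sum -mulr_sumr ut mulr1.
Qed.

Definition twist_eta : {linear M -> restr phi twist} := mklin twist_eta_linear.

Lemma twist_gen (x : twist) :
  x = \sum_k u k *: (twist_eta (twval x k) : twist).
Proof.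
apply: twval_inj => j; rewrite twval_sum -[LHS]twvalP; apply: eq_bigr => k _.
rewrite twvalZ; under eq_bigr do rewrite twval_eta scalerA -basisZ -mulrA.
by rewrite -scaler_suml -basis_sum -mulr_sumr ut mulr1.
Qed.

Section Ext.
Context (N : lmodType B) (f : {linear M -> restr phi N}).

Definition twist_ext_fun (x : twist) : N := \sum_k u k *: (f (twval x k) : N).

Fact twist_ext_linear : linear twist_ext_fun.
Proof.
have fZ a (m : M) : (f (a *: m) : N) = phi a *: (f m : N).
  exact: (linearZ_LR f a m).
move=> b x y; rewrite /twist_ext_fun.
have -> : b *: (\sum_k u k *: (f (twval x k) : N)) =
    \sum_k u k *: (f (twval (b *: x) k) : N).
  transitivity (\sum_j \sum_k (u j * phi (c j (b * u k))) *: (f (twval x k) : N)).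
    rewrite exchange_big scaler_sumr; apply: eq_bigr => k _.
    by rewrite scalerA -scaler_suml basis_decomp.
  apply: eq_bigr => j _; rewrite twvalZ (linear_sum f) scaler_sumr.
  by apply: eq_bigr => k _; rewrite fZ scalerA.
rewrite -big_split /=; apply: eq_bigr => k _.
by rewrite -scalerDr twvalD (linearD f).
Qed.

Definition twist_ext : {linear twist -> N} := mklin twist_ext_linear.

Lemma twist_ext_eta (m : M) : twist_ext (twist_eta m) = f m.
Proof.
have fZ a (x : M) : (f (a *: x) : N) = phi a *: (f x : N).
  exact: (linearZ_LR f a x).
rewrite /= /twist_ext_fun.
under eq_bigr do rewrite twval_eta fZ scalerA.
by rewrite -scaler_suml ut scale1r.
Qed.

End Ext.

(** Both maps are [B]-linear by [restr_linear_full], and [twist_gen] says that the image of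
    [twist_eta] generates. *)
Lemma twist_ext_uniq (N : lmodType B) (g h : {linear restr phi twist -> restr phi N}) :
  (forall m, g (twist_eta m) = h (twist_eta m)) -> g =1 h.
Proof.
move=> gh x; rewrite (twist_gen x) !linear_sum; apply: eq_bigr => k _.
by rewrite !restr_linear_full gh.
Qed.

(** A dual basis embeds [P] in a power of [A], hence of [B]; the embedding splits because [P] is
    injective. *)
Lemma projective_injective_embed (P : lmodType A) :
  projective_module P -> injective_module P ->
  exists (N : lmodType B) (i : {linear P -> restr phi N})
      (r : {linear restr phi N -> P}), forall x, r (i x) = x.
Proof.
move=> projP injP; have [th thP] := projective_dual_basis projP.
pose N := (P -> B^o : lmodType B).
pose i (x : P) : restr phi N := fun p => phi (th p x).
have ilin : linear i.
  move=> a x y; apply/funext => p.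
  by rewrite /i linearP rmorphD; congr (_ + _); exact: rmorphM.
have iinj : injective (mklin ilin).
  apply: linear_injective => x ix; rewrite [LHS]((thP x).2 [::])// ?big_nil//.
  move=> p _; apply: phi_inj; rewrite rmorph0.
  exact: (congr1 (fun h : P -> B => h p) ix).
have [r rE] := injective_split injP iinj.
by exists N, (mklin ilin), r.
Qed.

(** [P] is a retract of a [B]-module [N]: a map to [P] is extended into [N] and then retracted, and
    uniqueness is checked in [N]. *)
Lemma twist_universal (P : lmodType A) (f : {linear M -> P}) :
  projective_module P -> injective_module P ->
  exists! g : {linear restr phi twist -> P}, lin_comp g twist_eta = f.
Proof.
move=> projP injP.
have [N [i [r ri]]] := projective_injective_embed projP injP.
pose g := lin_comp r (restr_map phi (twist_ext (lin_comp i f))).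
have gE : lin_comp g twist_eta = f.
  apply: linear_ext => m.
  rewrite -[LHS]/(r (twist_ext (lin_comp i f) (twist_eta m))) twist_ext_eta.
  exact: ri.
exists g; split=> // g' g'E; apply: linear_ext => x.
have iinj : injective i by exact: can_inj ri.
apply: iinj; apply: (@twist_ext_uniq N (lin_comp i g) (lin_comp i g')) => m.
by rewrite -[LHS]/(i (lin_comp g twist_eta m)) gE -g'E.
Qed.

Lemma twist_eta_injective : (forall m : M, (forall j, t j *: m = 0) -> m = 0) ->
  injective twist_eta.
Proof.
move=> tm0; apply: linear_injective => m m0; apply: tm0 => j.
by rewrite -twval_eta -[twist_eta_fun m]/(twist_eta m) m0.
Qed.

End Twist.

Section TwistMap.
Context (M N : lmodType A) (f : {linear M -> N}).

Fact twist_map_subproof (x : twist_of M basis) j :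
  \sum_k c j (u k) *: f (twval x k) = f (twval x j).
Proof.
by rewrite -[in RHS]twvalP linear_sum; apply: eq_bigr => k _; rewrite linearZ.
Qed.

Definition twist_map_fun (x : twist_of M basis) : twist_of N basis :=
  mktwist (twist_map_subproof x).

Lemma twval_map x j : twval (twist_map_fun x) j = f (twval x j).
Proof. by []. Qed.

Fact twist_map_linear : linear twist_map_fun.
Proof.
move=> b x y; apply: twval_inj => j.
rewrite twvalD twvalZ !twval_map twvalD linearD twvalZ linear_sum.
by congr (_ + _); apply: eq_bigr => k _; rewrite linearZ.
Qed.

Definition twist_map : {linear twist_of M basis -> twist_of N basis} := mklin twist_map_linear.

End TwistMap.

End ConductorBasis.

(** * Modules over the quotient ring, seen over [R] *)

Section QuotientRing.
Context (R : pzRingType) (hered : left_hereditary R).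
Context (E : lmodType R) (iota : {linear R^o -> E}).
Context (envE : injective_envelope iota).
Local Notation Q := (Qmax envE).
Local Notation incl := (Qmax_incl envE).

Lemma Qmax_full (x : E) : x \in Qmax_pred iota.
Proof. by apply/Qmax_predP => h h0; exact: (iota_ker hered envE). Qed.

Definition toQ (x : E) : Q := Sub x (Qmax_full x).

Lemma toQK (q : Q) : toQ (val q) = q. Proof. exact: val_inj. Qed.

Lemma toQ_linear (a : R) x y : toQ (a *: x + y) = incl a * toQ x + toQ y.
Proof. by rewrite Qmax_inclM; apply: val_inj. Qed.

Lemma projective_of_Qmax :
  projective_module (R := R) (restr incl (Q^o : lmodType Q)) ->
  projective_module E.
Proof.
have tl : linear (toQ : E -> restr incl (Q^o : lmodType Q)).
  by move=> a x y; rewrite toQ_linear.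
have vl : linear (fun q : restr incl (Q^o : lmodType Q) => val (q : Q) : E).
  move=> a x y; have -> : a *: x + y = (incl a * (x : Q) + (y : Q) : Q) by [].
  by rewrite Qmax_inclM.
exact: (projective_retract (i := mklin tl) (r := mklin vl)).
Qed.

Section Projective.
Context (projE : projective_module E).

Lemma Qmax_conductor_basis : exists (n : nat) (t : 'I_n -> R) (u : 'I_n -> Q)
  (c : 'I_n -> Q -> R), conductor_basis incl t u c.
Proof.
have [n [t [u [tT ut]]]] := conductor_dual_basis hered envE projE.
have /choice[c cE] (p : 'I_n * Q) : exists a : R, incl a = incl (t p.1) * p.2.
  have [a aE] := tT p.1 (val p.2).
  by exists a; rewrite Qmax_inclM; apply: val_inj.
exists n, t, (fun j => toQ (u j)), (fun j q => c (j, q)); split.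
- exact: Qmax_incl_inj.
- by move=> j q; rewrite cE.
- apply: val_inj; rewrite [RHS]ut (raddf_sum (val : {additive Q -> E})).
  by apply: eq_bigr.
Qed.

Section Module.
Context (N : lmodType Q).

(** [N] is a quotient of a direct sum of copies of [E] indexed by its own elements. *)
Lemma Qmax_module_injective : injective_module (restr incl N).
Proof.
pose F (x : N) (e : E) : restr incl N := toQ e *: x.
have Flin x : linear (F x).
  by move=> a e e'; rewrite /F toQ_linear scalerDl -scalerA.
apply: (injective_quotient (p := dsum_lin (fun x => mklin (Flin x))) hered).
  exact: injective_dsum (noetherianR hered envE projE) (injE envE).
move=> x; exists (single (x : N) (iota 1)); rewrite dsum_lin_single /= /F.
have -> : toQ (iota 1) = 1 by apply: val_inj.
exact: (scale1r (x : N)).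
Qed.

End Module.

Lemma Qmax_free_projective (I : choiceType) :
  projective_module (R := R) (restr incl (dsum I (Q^o : lmodType Q))).
Proof.
pose i (f : restr incl (dsum I (Q^o : lmodType Q))) : dsum I E :=
  mkdsum (V := E) (dsupp f) (fun x => val (dval f x : Q)).
have iE f x : dval (i f) x = val (dval f x : Q).
  rewrite -[LHS]/(if x \in dsupp f then val (dval f x : Q) else 0).
  by case: ifPn => // /dsuppP ->.
pose r (f : dsum I E) : restr incl (dsum I (Q^o : lmodType Q)) :=
  mkdsum (V := Q^o : lmodType Q) (dsupp f) (fun x => toQ (dval f x)).
have toQ0 : toQ 0 = 0 by apply: val_inj.
have rE f x : dval (r f) x = toQ (dval f x).
  rewrite -[LHS]/(if x \in dsupp f then toQ (dval f x) else 0).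
  by case: ifPn => // /dsuppP ->.
have dvalP a (f g : restr incl (dsum I (Q^o : lmodType Q))) x :
    dval (a *: f + g) x = incl a * (dval f x : Q) + (dval g x : Q).
  exact: (@linearP _ _ _ _ (dcoord (Q^o : lmodType Q) x) (incl a) f g).
have dvalP' a (f g : dsum I E) x : dval (a *: f + g) x = a *: dval f x + dval g x.
  exact: (@linearP _ _ _ _ (dcoord E x) a f g).
have ilin : linear i.
  move=> a f g; apply: dval_inj => x.
  by rewrite [RHS]dvalP' !iE dvalP Qmax_inclM.
have rlin : linear r.
  move=> a f g; apply: dval_inj => x.
  by rewrite [RHS]dvalP !rE dvalP' toQ_linear.
apply: (projective_retract (i := mklin ilin) (r := mklin rlin)).
  by move=> f; apply: dval_inj => x; rewrite rE iE toQK.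
exact: projective_dsum.
Qed.

(** The kernel of a free cover over [Q] is itself a [Q]-module, hence injective over [R] and a
    summand. *)
Lemma Qmax_module_projective (N : lmodType Q) :
  projective_module (R := R) (restr incl N).
Proof.
pose F := dsum N (Q^o : lmodType Q).
pose p : {linear F -> N} := dsum_lin (@smul Q N).
pose K := mksub (is_submod_ker p).
pose k : {linear submod K -> F} := (val : {linear submod K -> F}).
have [rho rhoE] := injective_split (i := restr_map incl k)
  (@Qmax_module_injective (submod K)) val_inj.
pose kr : {linear restr incl F -> restr incl F} := lin_comp (restr_map incl k) rho.
have krE (y : restr incl F) : p (y : F) = 0 -> kr y = y.
  move=> py0; have yK : (y : F) \in K by apply/in_mksub.
  have yE : y = restr_map incl k (Sub (y : F) yK : submod K) by [].
  rewrite [in LHS]yE [RHS]yE; exact: (congr1 (restr_map incl k) (rhoE _)).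
have pkr (y : restr incl F) : p (kr y : F) = 0.
  exact/(in_mksub (is_submod_ker p))/(valP (rho y : submod K)).
pose s (x : restr incl N) : restr incl F :=
  single (x : N) (1 : Q^o) - kr (single (x : N) (1 : Q^o)).
have ps (x : restr incl N) : p (s x : F) = x.
  have p1 : p (single (x : N) (1 : Q^o)) = x.
    by rewrite /p dsum_lin_single smulE scale1r.
  by rewrite (linearB p) pkr p1 subr0.
have krs (x : restr incl N) : kr (s x) = 0.
  have krkr y : kr (kr y) = kr y by apply: krE; exact: pkr.
  by rewrite (linearB kr) krkr subrr.
(* [single x 1] is not linear in [x]. The defect [d] of [s] lies in the kernel of [p], so [kr] fixes
   it, and [kr] also kills it. *)
have slin : linear s.
  move=> a x y; apply/eqP; rewrite -subr_eq0; apply/eqP.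
  set d := _ - _; have pd : p (d : F) = 0.
    rewrite (linearB p) ps.
    rewrite -[p (_ + _)]/(restr_map incl p (a *: s x + s y)) linearP.
    rewrite -[restr_map incl p (s x)]/(p (s x : F)).
    rewrite -[restr_map incl p (s y)]/(p (s y : F)).
    by rewrite !ps subrr.
  by rewrite -(krE _ pd) (linearB kr) (linearP kr) !krs scaler0 addr0 subr0.
apply: (projective_retract (i := mklin slin) (r := restr_map incl p)) => //.
exact: Qmax_free_projective.
Qed.

End Projective.
End QuotientRing.

(** * Reflections *)

Section Categories.

Lemma functor_ext (C D : category) (F : C -> D)
    (f : forall x y, Hom x y -> Hom (F x) (F y)) p1 pM q1 qM :
  @Functor C D F f p1 pM = @Functor C D F f q1 qM.
Proof. by rewrite (Prop_irrelevance p1 q1) (Prop_irrelevance pM qM). Qed.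

Lemma adjunction_of_universal (C D : category) (L : functor C D)
    (G : functor D C) (eta : nattrans (idF C) (compF G L)) :
  (forall x d (f : Hom x (G d)),
    exists! g : Hom (L x) d, cmp (fmap G g) (eta x) = f) ->
  exists adj : adjunction L G, unit_adj adj = eta.
Proof.
move=> univ.
have uniq x d (g h : Hom (L x) d) :
    cmp (fmap G g) (eta x) = cmp (fmap G h) (eta x) -> g = h.
  move=> gh; have [k [_ kE]] := univ x d (cmp (fmap G h) (eta x)).
  by rewrite -(kE g gh) -(kE h erefl).
have univ1 d : exists g : Hom (L (G d)) d, cmp (fmap G g) (eta (G d)) = idm (G d).
  by have [g [gE _]] := univ (G d) d (idm (G d)); exists g.
pose eps d := sval (cid (univ1 d)).
have epsE d : cmp (fmap G (eps d)) (eta (G d)) = idm (G d).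
  exact: (svalP (cid (univ1 d))).
have nat_eta x y (f : Hom x y) :
    cmp (fmap G (fmap L f)) (eta x) = cmp (eta y) f.
  exact: (esym (ncompE eta f)).
have eps_nat x y (f : Hom x y) :
    cmp (eps y) (fmap (compF L G) f) = cmp (fmap (idF D) f) (eps x).
  apply: uniq; rewrite [fmap _ (cmp _ _)]fmapM -cmpA [cmp _ (eta _)]nat_eta.
  rewrite cmpA epsE cmp1m [fmap _ (cmp _ _)]fmapM -cmpA epsE.
  by rewrite cmpm1.
have triL x : cmp (eps (L x)) (fmap L (eta x)) = idm (L x).
  apply: uniq; rewrite fmapM -cmpA [cmp _ (eta x)]nat_eta cmpA epsE.
  by rewrite fmap1.
by exists (@Adjunction C D L G eta
  (@NatTrans D D (compF L G) (idF D) eps eps_nat) triL epsE).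
Qed.

Lemma adjunction_mono (C D : category) (L : functor C D) (G : functor D C)
    (adj : adjunction L G) : preserves_mono G.
Proof.
move=> x y f fmono z g h gh.
have transp (k : Hom z (G x)) :
    k = cmp (fmap G (cmp (counit_adj adj x) (fmap L k))) (unit_adj adj z).
  rewrite fmapM -cmpA.
  rewrite -[cmp (fmap G (fmap L k)) _](ncompE (unit_adj adj) k) cmpA.
  by rewrite triangleR cmp1m.
rewrite (transp g) (transp h); congr (cmp (fmap G _) _); apply: fmono.
have nat_eps (k : Hom z (G x)) : cmp f (cmp (counit_adj adj x) (fmap L k)) =
    cmp (counit_adj adj y) (fmap L (cmp (fmap G f) k)).
  by rewrite fmapM !cmpA -[cmp f _](ncompE (counit_adj adj) f).
by rewrite !nat_eps gh.
Qed.

Section Corestriction.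
Context (C D : category) (F : functor C D) (P : D -> Prop).
Context (PF : forall x, P (F x)).

Definition corestrict : functor C (full_sub P) :=
  @Functor C (full_sub P) (fun x => exist P (F x) (PF x))
    (fun x y f => fmap F f) (fmap1 F) (fmapM F).

Lemma left_exact_corestrict : left_exact F -> left_exact corestrict.
Proof.
move=> lexF J finJ X c lim_c c'.
pose c'' := @Cone J D (compF F X) (sval (apex c')) (leg c') (legE c').
exact: (lexF J finJ X c lim_c c'').
Qed.

End Corestriction.

Section KernelPair.

(** The shape of a pullback, as a poset with top [None]; a morphism is a proof of a boolean
    equation, hence unique. *)
Let le (i j : option bool) : bool := (i == j) || (j == None).

Fact cospan_refl i : le i i. Proof. by rewrite /le eqxx. Qed.

Fact cospan_trans i j k : le j k -> le i j -> le i k.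
Proof. by case: i j k => [[]|] [[]|] [[]|]. Qed.

Definition cospan : category :=
  @Category (option bool) (fun i j => le i j) cospan_refl
    (fun i j k => @cospan_trans i j k) (fun _ _ _ => bool_irrelevance _ _)
    (fun _ _ _ => bool_irrelevance _ _)
    (fun _ _ _ _ _ _ _ => bool_irrelevance _ _).

Lemma finite_cospan : finite_category cospan.
Proof.
split=> [|i j].
  exists #|{: option bool}|, enum_val => x.
  by exists (enum_rank x); rewrite enum_rankK.
have [ij|ij] := boolP (le i j).
  by exists 1%N, (fun=> ij) => u; exists ord0; exact: bool_irrelevance.
by exists 0%N, (fun i0 : 'I_0 => False_rect _ (notF (ltn_ord i0))) => u;
  case/negP: ij.
Qed.

Context (C : category) (x y : C) (f : Hom x y).

Let ob (i : option bool) : C := if i is Some _ then x else y.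

Let mor (i j : option bool) : le i j -> Hom (ob i) (ob j) :=
  match i, j return le i j -> Hom (ob i) (ob j) with
  | Some _, Some _ => fun=> idm x
  | Some _, None => fun=> f
  | None, Some _ => fun u => False_rect _ (notF u)
  | None, None => fun=> idm y
  end.

Let lg (i : option bool) : Hom x (ob i) :=
  if i is Some _ then idm x else f.

Fact kernel_pair1 (i : cospan) : mor (idm i) = idm (ob i).
Proof. by case: i => // b. Qed.

Fact kernel_pairM (i j k : cospan) (v : Hom j k) (u : Hom i j) :
  mor (cmp v u) = cmp (mor v) (mor u).
Proof.
by case: i j k v u => [a|] [b|] [d|] v u //=; rewrite ?cmp1m ?cmpm1.
Qed.

Definition kernel_pair : functor cospan C :=
  @Functor cospan C ob mor kernel_pair1 kernel_pairM.

Fact kernel_pair_legE (i j : cospan) (u : Hom i j) :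
  cmp (fmap kernel_pair u) (lg i) = lg j.
Proof. by case: i j u => [a|] [b|] u //=; rewrite ?cmp1m ?cmpm1. Qed.

Definition kernel_pair_cone : cone kernel_pair :=
  @Cone cospan C kernel_pair x lg kernel_pair_legE.

Lemma kernel_pair_limit : mono f -> is_limit kernel_pair_cone.
Proof.
move=> fmono c.
have legT b : cmp f (leg c (Some b)) = leg c None.
  exact: (legE c (isT : le (Some b) None)).
exists (leg c (Some true)); split=> [[b|]|u uE] /=.
- by rewrite cmp1m; apply: fmono; rewrite !legT.
- exact: legT.
- by rewrite -(uE (Some true)) /= cmp1m.
Qed.

End KernelPair.

(** A monomorphism has a trivial kernel pair, and [F] preserves this limit; two maps equalised by
    [fmap F f] then come from one map into the apex. *)
Lemma left_exact_mono (C D : category) (F : functor C D) :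
  left_exact F -> preserves_mono F.
Proof.
move=> lexF x y f fmono z g h gh.
have := lexF _ finite_cospan _ _ (kernel_pair_limit fmono).
set X := compF F (kernel_pair f).
pose l (i : option bool) : Hom z (X i) :=
  match i return Hom z (X i) with
  | Some true => g | Some false => h | None => cmp (fmap F f) g
  end.
have lE (i j : cospan) (u : Hom i j) : cmp (fmap X u) (l i) = l j.
  case: i j u => [[]|] [[]|] u //=; rewrite ?fmap1 ?cmp1m//.
move=> /(_ (Cone lE))[u [uE _]].
have := uE (Some true); have := uE (Some false).
by rewrite /= fmap1 !cmp1m => <- <-.
Qed.

End Categories.

(** * Monomorphisms and limits of modules *)

Section ModuleCategory.
Context (R : pzRingType).

(** Elements are maps from [R^o]. Testing on [R^o] alone also covers monomorphisms between
    projective modules. *)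
Lemma injective_of_regular (M N : lmodType R) (f : {linear M -> N}) :
  (forall g h : {linear R^o -> M}, lin_comp f g = lin_comp f h -> g = h) ->
  injective f.
Proof.
move=> fmono x y fxy.
have /fmono xy : lin_comp f (smul x) = lin_comp f (smul y).
  by apply: linear_ext => r; rewrite /= !linearZ fxy.
by rewrite -[x]scale1r -[y]scale1r -!smulE xy.
Qed.

Lemma mono_injective (M N : Mod R) (f : Hom M N) :
  mono f <-> injective (f : {linear (M : lmodType R) -> (N : lmodType R)}).
Proof.
split=> [fmono|finj z g h gh]; first exact: injective_of_regular (fmono (regMod R)).
apply: linear_ext => x; apply: finj.
exact: (congr1 (fun k : {linear (z : lmodType R) -> (N : lmodType R)} => k x) gh).
Qed.

Lemma limit_elements (J : category) (X : functor J (Mod R)) (c : cone X)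
    (x : forall j, (X j : lmodType R)) : is_limit c ->
  (forall i j (u : Hom i j),
    (fmap X u : {linear (X i : lmodType R) -> (X j : lmodType R)}) (x i) = x j) ->
  exists! m : (apex c : lmodType R), forall j,
    (leg c j : {linear (apex c : lmodType R) -> (X j : lmodType R)}) m = x j.
Proof.
move=> lim_c xE.
have lE i j (u : Hom i j) : @cmp (Mod R) _ _ _ (fmap X u) (smul (x i)) = smul (x j).
  by apply: linear_ext => r; rewrite /= linearZ xE.
pose c' := @Cone J (Mod R) X (R^o : lmodType R) (fun j => smul (x j)) lE.
have [g [gE guniq]] := lim_c c'.
pose g' : {linear R^o -> (apex c : lmodType R)} := g.
exists (g' 1); split=> [j|m mE].
  have /(congr1 (fun k : {linear R^o -> (X j : lmodType R)} => k 1)) := gE j.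
  by rewrite /= scale1r.
rewrite /g' (guniq (smul m)) ?smulE ?scale1r// => j.
by apply: linear_ext => r; rewrite /= linearZ mE.
Qed.

(** [h] is injective because [R] is essential in [E]; as [E] is injective, it is then a retract of
    [P]. *)
Lemma projective_of_embedding (E P : lmodType R) (iota : {linear R^o -> E})
    (h : {linear E -> P}) : injective_envelope iota ->
  injective (h \o iota) -> projective_module P -> projective_module E.
Proof.
move=> envE hinj projP.
have {}hinj : injective h.
  apply: linear_injective => x hx; apply: contrapT => x0.
  have [r [a [aE rx]]] := essentialP envE x0.
  have a0 : a = 0.
    by apply: hinj; rewrite /= aE linearZ /= hx scaler0 !linear0.
  by apply: rx; rewrite -aE a0 linear0.
have [r ri] := injective_split (injE envE) hinj.
exact: projective_retract ri projP.
Qed.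

Lemma projective_of_embedding1 (E P : lmodType R) (iota : {linear R^o -> E})
    (f : {linear R^o -> P}) : injective_envelope iota ->
  injective f -> projective_module P -> injective_module P ->
  projective_module E.
Proof.
move=> envE finj projP injP.
have [h hE] := injP _ _ iota f (iota_inj envE).
apply: (projective_of_embedding (h := h) envE) projP.
by move=> a b /=; rewrite !hE => /finj.
Qed.

End ModuleCategory.

(** * Extension of scalars as a left exact functor *)

Section TwistFunctor.
Context (A B : pzRingType) (phi : {rmorphism A -> B}).
Context (n : nat) (t : 'I_n -> A) (u : 'I_n -> B) (c : 'I_n -> B -> A).
Context (basis : conductor_basis phi t u c).

Fact twist_map1 (M : lmodType A) :
  twist_map basis (lin_id M) = lin_id (twist_of M basis).
Proof. by apply: linear_ext => x; apply: twval_inj. Qed.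

Fact twist_mapM (M N P : lmodType A) (g : {linear N -> P}) (f : {linear M -> N}) :
  twist_map basis (lin_comp g f) =
  lin_comp (twist_map basis g) (twist_map basis f).
Proof. by apply: linear_ext => x; apply: twval_inj. Qed.

Definition twist_functor : functor (Mod A) (Mod B) :=
  @Functor (Mod A) (Mod B) (fun M => twist_of M basis : lmodType B)
    (fun M N f => twist_map basis f) twist_map1 twist_mapM.

Definition twistR : functor (Mod A) (Mod A) := compF (Mod_restr phi) twist_functor.

Fact twist_eta_nat (M N : lmodType A) (f : {linear M -> N}) :
  lin_comp (twist_eta basis N) f =
  lin_comp (restr_map phi (twist_map basis f)) (twist_eta basis M).
Proof.
apply: linear_ext => m; apply: twval_inj => j.
rewrite -[LHS]/(t j *: f m) -[RHS]/(f (t j *: m)).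
by rewrite linearZ.
Qed.

(** Coordinates are lifted to the limit one at a time. The fixed-point equations and linearity hold
    because the legs separate the elements of the limit. *)
Lemma twistR_left_exact : left_exact twistR.
Proof.
move=> J _ X c0 lim_c d; pose P : lmodType A := apex d.
pose g j : {linear P -> restr phi (twist_of (X j) basis)} := leg d j.
have gE i j (w : Hom i j) p k :
    twval (g j p : twist_of (X j) basis) k =
    (fmap X w : {linear (X i : lmodType A) -> (X j : lmodType A)})
      (twval (g i p : twist_of (X i) basis) k).
  have := legE d w.
  move/(congr1 (fun h : {linear P -> restr phi (twist_of (X j) basis)} =>
    twval (h p : twist_of (X j) basis) k)) => <-.
  by [].
have L p k := limit_elements lim_c (x := fun j => twval (g j p : twist_of (X j) basis) k)
  (fun i j w => esym (gE i j w p k)).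
have [m mE] := choice (fun pk : P * 'I_n => L pk.1 pk.2).
pose l j : {linear (apex c0 : lmodType A) -> (X j : lmodType A)} := leg c0 j.
have lm j p k : l j (m (p, k)) = twval (g j p : twist_of (X j) basis) k.
  exact: (mE (p, k)).1.
have luniq (y z : (apex c0 : lmodType A)) : (forall j, l j y = l j z) -> y = z.
  move=> yz.
  have [|w [_ wuniq]] := limit_elements lim_c (x := fun j => l j z).
    move=> i j w; have := legE c0 w.
    by move/(congr1 (fun h : {linear (apex c0 : lmodType A) -> (X j : lmodType A)} => h z)).
  by rewrite -(wuniq y yz) -(wuniq z (fun=> erefl)).
have mfix p j : \sum_k c j (u k) *: m (p, k) = m (p, j).
  apply: luniq => i; rewrite lm linear_sum -[RHS]twvalP.
  by apply: eq_bigr => k _; rewrite linearZ lm.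
pose h (p : P) : restr phi (twist_of (apex c0) basis) := mktwist basis (mfix p).
have hE p k : twval (h p : twist_of (apex c0) basis) k = m (p, k) by [].
have hlin : linear h.
  move=> a x y; apply: twval_inj => j; apply: luniq => i.
  rewrite hE lm (linearP (g i)).
  transitivity (\sum_k c j (phi a * u k) *: twval (g i x : twist_of (X i) basis) k +
    twval (g i y : twist_of (X i) basis) j); first by [].
  transitivity (l i (\sum_k c j (phi a * u k) *: m (x, k) + m (y, j))); last by [].
  rewrite linearD linear_sum lm; congr (_ + _); apply: eq_bigr => k _.
  by rewrite linearZ lm.
exists (mklin hlin); split=> [j|h' h'E].
  apply: linear_ext => p; apply: twval_inj => k.
  exact: (lm j p k).
apply: linear_ext => p; apply: twval_inj => k; apply: luniq => i.
rewrite hE lm; have := h'E i.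
move/(congr1 (fun h : {linear P -> restr phi (twist_of (X i) basis)} =>
    twval (h p : twist_of (X i) basis) k)) => /esym.
by [].
Qed.

End TwistFunctor.

(** * The implications between the conditions *)

Section Equivalences.
Context (R : pzRingType) (hered : left_hereditary R).
Context (E : lmodType R) (iota : {linear R^o -> E}).
Context (envE : injective_envelope iota).
Local Notation Q := (Qmax envE).
Local Notation incl := (Qmax_incl envE).

Lemma QF3plusP : left_QF3plus R <-> projective_module E.
Proof.
split=> [[P [f [envP projP]]]|projE]; last by exists E, iota.
exact: projective_of_embedding1 envE (iota_inj envP) projP (injE envP).
Qed.

(** By naturality, the unit at [E] restricted to [R] is the image of [iota] after the unit at [R].
    Both are injective, as right adjoints preserve monomorphisms. *)
Lemma mono_reflection_projective (X : ModPr R -> Prop)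
    (r : functor (Mod R) (full_sub X))
    (adj : adjunction r (compF (embPr R) (emb X))) :
  preserves_mono r -> mono (unit_adj adj (regMod R)) -> projective_module E.
Proof.
move=> rmono /mono_injective etaR_inj.
pose G := compF (embPr R) (emb X).
pose eta (M : lmodType R) : {linear M -> (G (r M) : lmodType R)} := unit_adj adj M.
pose ri : {linear (G (r (R^o : lmodType R)) : lmodType R) ->
  (G (r E) : lmodType R)} := fmap G (fmap r (iota : Hom (regMod R) (E : Mod R))).
have ri_inj : injective ri.
  apply/mono_injective/(adjunction_mono adj)/rmono/mono_injective.
  exact: iota_inj envE.
apply: (projective_of_embedding (h := eta E) envE); last exact: svalP (sval (r E)).
have nat_eta a : eta E (iota a) = ri (eta _ a).
  have := ncompE (unit_adj adj) (iota : Hom (regMod R) (E : Mod R)).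
  exact: (congr1 (fun k : {linear R^o -> (G (r E) : lmodType R)} => k a)).
by move=> a b /=; rewrite !nat_eta => /ri_inj/etaR_inj.
Qed.

Section Projective.
Context (projE : projective_module E).
Context (n : nat) (t : 'I_n -> R) (u : 'I_n -> Q) (c : 'I_n -> Q -> R).
Context (basis : conductor_basis incl t u c).
Let T := twistR basis.

Fact reflection_subproof (M : lmodType R) :
  projective_module (T M : lmodType R) /\ injective_module (T M : lmodType R).
Proof.
split; first exact: Qmax_module_projective.
exact: Qmax_module_injective.
Qed.

Lemma reflection_unit_injective : injective (twist_eta basis (R^o : lmodType R)).
Proof.
apply: twist_eta_injective => a ta; have [incl_inj _ ut] := basis.
apply: incl_inj; rewrite rmorph0 -[LHS]mul1r -ut mulr_suml big1// => j _.
rewrite -mulrA -rmorphM; have -> : t j * a = 0 by exact: ta.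
by rewrite rmorph0 mulr0.
Qed.

Lemma reflection_Mod : exists (r : functor (Mod R) (ModPrInj R))
  (adj : adjunction r (embPrInj R)), mono (unit_adj adj (regMod R)).
Proof.
pose L : functor (Mod R) (ModPrInj R) := corestrict (F := T) reflection_subproof.
pose eta := @NatTrans _ _ (idF (Mod R)) (compF (embPrInj R) L)
  (fun M => twist_eta basis M) (@twist_eta_nat _ _ _ _ _ _ _ basis).
have [|adj adjE] := @adjunction_of_universal _ _ L (embPrInj R) eta.
  by move=> M P f; exact: (twist_universal basis f (svalP P).1 (svalP P).2).
exists L, adj; rewrite adjE; apply/mono_injective.
exact: reflection_unit_injective.
Qed.

Lemma reflection_ModPr : exists (r : functor (ModPr R) (ModPrInj R))
  (adj : adjunction r (embPrInjPr R)), mono (unit_adj adj (regModPr R)).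
Proof.
pose L : functor (ModPr R) (ModPrInj R) :=
  compF (corestrict (F := T) reflection_subproof) (embPr R).
pose eta := @NatTrans _ _ (idF (ModPr R)) (compF (embPrInjPr R) L)
  (fun M => twist_eta basis (sval M))
  (fun M N f => @twist_eta_nat _ _ _ _ _ _ _ basis (sval M) (sval N) f).
have [|adj adjE] := @adjunction_of_universal _ _ L (embPrInjPr R) eta.
  by move=> M P f; exact: (twist_universal basis f (svalP P).1 (svalP P).2).
exists L, adj; rewrite adjE => M g h gh.
have /mono_injective := reflection_unit_injective.
by move/(_ (sval M : Mod R) g h gh).
Qed.

Lemma reflection_left_exact : exists (X : ModPr R -> Prop)
  (r : functor (Mod R) (full_sub X))
  (adj : adjunction r (compF (embPr R) (emb X))),
  left_exact r /\ mono (unit_adj adj (regMod R)).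
Proof.
(* These are the modules that are both projective and injective, so the reflection of
   [reflection_Mod] serves again. *)
pose X (P : ModPr R) := injective_module (sval P : lmodType R).
pose L0 : functor (Mod R) (ModPr R) :=
  corestrict (F := T) (fun M => (reflection_subproof M).1).
pose L : functor (Mod R) (full_sub X) :=
  corestrict (F := L0) (P := X) (fun M => (reflection_subproof M).2).
pose G := compF (embPr R) (emb X).
pose eta := @NatTrans _ _ (idF (Mod R)) (compF G L)
  (fun M => twist_eta basis M) (@twist_eta_nat _ _ _ _ _ _ _ basis).
have [|adj adjE] := @adjunction_of_universal _ _ L G eta.
  by move=> M P f; exact: (twist_universal basis f (svalP (sval P)) (svalP P)).
exists X, L, adj; split.
  by do 2!apply: left_exact_corestrict; exact: twistR_left_exact.
rewrite adjE; apply/mono_injective; exact: reflection_unit_injective.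
Qed.

Lemma restriction_full_faithful : exists U : functor (Mod Q) (ModPr R),
  [/\ full U, faithful U & Mod_restr incl = compF (embPr R) U].
Proof.
pose U : functor (Mod Q) (ModPr R) :=
  corestrict (F := Mod_restr incl) (Qmax_module_projective hered projE).
exists U; split; last exact: functor_ext.
- move=> M N g; pose g' : {linear restr incl M -> restr incl N} := g.
  have glin : linear (fun x : (M : lmodType Q) => g' x : (N : lmodType Q)).
    move=> b x y; rewrite -(restr_linear_full basis g').
    exact: (linearD g' (b *: (x : (M : lmodType Q))) y).
  by exists (mklin glin); exact: linear_ext.
- move=> M N f g fg; apply: linear_ext => x.
  exact: (congr1 (fun k : {linear restr incl M -> restr incl N} => k x) fg).
Qed.

End Projective.

Lemma Qmax_modules_projective (U : functor (Mod Q) (ModPr R)) :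
  Mod_restr incl = compF (embPr R) U ->
  forall N : lmodType Q, projective_module (R := R) (restr incl N).
Proof.
move=> UE N; rewrite -[restr incl N : lmodType R]/(Mod_restr incl N : lmodType R).
by rewrite UE; exact: svalP (U N).
Qed.

End Equivalences.

Theorem theorem4p12 (R : pzRingType) (R_hereditary : left_hereditary R)
    (E : lmodType R) (iota : {linear R^o -> E})
    (envE : injective_envelope iota) :
  [<-> (* 1 *) left_QF3plus R ;
       (* 2 *) exists (r : functor (Mod R) (ModPrInj R))
                 (adj : adjunction r (embPrInj R)),
               mono (unit_adj adj (regMod R)) ;
       (* 3 *) exists (r : functor (ModPr R) (ModPrInj R))
                 (adj : adjunction r (embPrInjPr R)),
               mono (unit_adj adj (regModPr R)) ;
       (* 4 *) exists (X : ModPr R -> Prop)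
                 (r : functor (Mod R) (full_sub X))
                 (adj : adjunction r (compF (embPr R) (emb X))),
               left_exact r /\ mono (unit_adj adj (regMod R)) ;
       (* 5 *) exists (X : ModPr R -> Prop)
                 (r : functor (Mod R) (full_sub X))
                 (adj : adjunction r (compF (embPr R) (emb X))),
               preserves_mono r /\ mono (unit_adj adj (regMod R)) ;
       (* 6 *) projective_module (R := R^c) (right_restr (Qmax_incl envE)) /\
               exists U : functor (Mod (Qmax envE)) (ModPr R),
                 [/\ full U, faithful U &
                     Mod_restr (Qmax_incl envE) = compF (embPr R) U] ;
       (* 7 *) projective_module (R := R^c) (right_restr (Qmax_incl envE)) /\
               forall N : lmodType (Qmax envE),
                 projective_module (R := R) (restr (Qmax_incl envE) N) ].
Proof.
have basisE (projE : projective_module E) :=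
  Qmax_conductor_basis R_hereditary envE projE.
tfae.
- move/(QF3plusP envE) => projE; have [n [t [u [c basis]]]] := basisE projE.
  exact (reflection_Mod R_hereditary projE basis).
- move=> [r [adj /mono_injective etaR]].
  have projE : projective_module E.
    have [projP injP] := svalP (r (regMod R)).
    exact: projective_of_embedding1 envE etaR projP injP.
  have [n [t [u [c basis]]]] := basisE projE.
  exact (reflection_ModPr R_hereditary projE basis).
- move=> [r [adj etaR]].
  have projE : projective_module E.
    have [projP injP] := svalP (r (regModPr R)).
    apply: (projective_of_embedding1 envE _ projP injP).
    exact: injective_of_regular (etaR (regModPr R)).
  have [n [t [u [c basis]]]] := basisE projE.
  exact (reflection_left_exact R_hereditary projE basis).
- move=> [X [r [adj [lexr etaR]]]]; exists X, r, adj; split=> //.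
  exact: left_exact_mono.
- move=> [X [r [adj [rmono etaR]]]].
  have projE := mono_reflection_projective envE rmono etaR.
  have [n [t [u [c basis]]]] := basisE projE; split.
    exact (conductor_basis_projective basis).
  exact (restriction_full_faithful R_hereditary projE basis).
- by move=> [projQ [U [_ _ UE]]]; split=> //; exact: Qmax_modules_projective UE.
- move=> [_ projN]; apply/(QF3plusP envE).
  exact (projective_of_Qmax R_hereditary (projN _)).
Qed.
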